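(* Let $Q$ be a polygon and $f: \mathbb{N} \to \mathbb{N}$ be a monotonically increasing function. Then there is a dense $G_\delta$-set $G \subset P_Q$ of full $\mu$-measure such that for every $z \in G$ there exists an infinite strictly increasing sequence $n_i$ such that $$B\left (z,\frac{1}{n_i^2 f(n_i)} \right ) \subset C_{n_i}(z).$$
   Context: A polygon $Q$ is a planar polygon (not assumed convex). The billiard flow $\phi_t$ in $Q$ is the free motion of a point particle with unit speed and specular reflections from the boundary; reflections are not defined at corners. The billiard map $S$ is the first return map of the billiard flow to the boundary $\partial Q$; it is not defined for points for which the next arrival to the boundary is a vertex. The phase space $P_Q$ of $S$ is the set of inward pointing unit vectors with foot point in $\partial Q$. A vector $z\in P_Q$ is written $z=(s,\theta)$, where $s$ is the foot point in the arc length parametrization of $\partial Q$ and $\theta$ is the angle the vector makes with the positive direction of the boundary ($\partial Q$ is positively oriented; the angle at vertices is defined by one-sided continuity). $\mu$ is the $S$-invariant Liouville measure on $P_Q$, $d\mu = \sin\theta \, d\theta\, ds$. $P_Q$ carries the $L_1$ metric $d((s,\theta),(s',\theta'))= |s-s'|+|\theta - \theta'|$, and $B(z,\varepsilon)$ is the $L_1$-ball in $P_Q$ centered at $z$ of radius $\varepsilon$. Label the sides of $Q$ by distinct letters of a finite alphabet and code each forward orbit by the sequence of sides it hits. For $z\in P_Q$ such that $S^n(z)$ is defined, the $n$-cell $C_n(z)$ is the open set of points for which $S^n$ is defined and whose coding sequence up to time $n$ coincides with that of $z$; equivalently, it is the largest open set containing $z$ on which $S^n$ is continuous. *)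

(* Defs.v *)
From HB Require Import structures.
From mathcomp Require Import all_boot all_order all_algebra.
From mathcomp Require Import all_classical all_reals all_analysis borel_hierarchy.
Set Implicit Arguments.
Unset Strict Implicit.
Unset Printing Implicit Defensive.
Import Order.TTheory GRing.Theory Num.Theory.
Import numFieldNormedType.Exports.
Local Open Scope classical_set_scope.
Local Open Scope ring_scope.

Definition dot (R : realType) (p q : R * R) : R := p.1 * q.1 + p.2 * q.2.

(* Euclidean norm: the library's norm on [R * R] is the sup norm. *)
Definition enorm (R : realType) (p : R * R) : R := Num.sqrt (dot p p).

(* Rotation by +pi/2: [rot90 p] points to the left of [p]. *)
Definition rot90 (R : realType) (p : R * R) : R * R := (- p.2, p.1).

(* The point with affine parameter [a] on the [j]-th side, which goes from
   [v j] to the cyclically next vertex [v (ordS j)]. *)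
Definition side_point (R : realType) (N : nat) (v : 'I_N -> R * R)
  (j : 'I_N) (a : R) : R * R := v j + a *: (v (ordS j) - v j).

Definition polyline (R : realType) (N : nat) (v : 'I_N -> R * R) :
  set (R * R) :=
  [set p | exists j a, 0 <= a <= 1 /\ p = side_point v j a].

(* The points enclosed by the closed polygonal curve: those whose connected
   component in the complement of the curve is bounded. *)
Definition enclosed (R : realType) (N : nat) (v : 'I_N -> R * R) :
  set (R * R) :=
  [set p | (~` polyline v) p /\
           bounded_set (connected_component (~` polyline v) p)].

(* Polygons bounded by a simple closed polygonal curve; no convexity is
   assumed. [simple] says that the closed curve is traversed injectively
   (half-open sides are nondegenerate and pairwise disjoint); [positive] is the
   positive orientation: the enclosed region lies to the left of every side. *)
Record polygon (R : realType) := Polygon {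
  nsides : nat;
  vertex : 'I_nsides -> R * R;
  nsides_ge3 : (3 <= nsides)%N;
  simple : forall (i j : 'I_nsides) (a b : R), 0 <= a < 1 -> 0 <= b < 1 ->
    side_point vertex i a = side_point vertex j b -> i = j /\ a = b;
  positive : forall (j : 'I_nsides) (a : R), 0 < a < 1 ->
    exists2 e : R, 0 < e & forall t : R, 0 < t < e ->
      enclosed vertex
        (side_point vertex j a + t *: rot90 (vertex (ordS j) - vertex j))
}.

Section Billiard.
Variables (R : realType) (Q : polygon R).
Local Notation side := ('I_(nsides Q)).

Definition interior_of : set (R * R) := enclosed (@vertex R Q).

Definition side_length (j : side) : R :=
  enorm (vertex (ordS j) - vertex j).

Definition tangent (j : side) : R * R :=
  (side_length j)^-1 *: (vertex (ordS j) - vertex j).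

Definition normal (j : side) : R * R := rot90 (tangent j).

(* Arc length parameter of [vertex j], measured from vertex 0. *)
Definition arc_start (j : side) : R :=
  \sum_(i < nsides Q | (i < j)%N) side_length i.

(* The arc length parameter [s] belongs to the [j]-th side. Sides are half-open,
   so a vertex is attached to the side that starts there; this is the one-sided
   convention used to define angles at vertices. *)
Definition on_side (j : side) (s : R) : bool :=
  arc_start j <= s < arc_start j + side_length j.

Definition foot (j : side) (s : R) : R * R :=
  vertex j + (s - arc_start j) *: tangent j.

(* The unit vector making the angle [theta] with the [j]-th side. *)
Definition direction (j : side) (theta : R) : R * R :=
  cos theta *: tangent j + sin theta *: normal j.

(* The phase space P_Q, in the coordinates z = (s, theta). The last condition
   (the vector points into Q) only matters when the foot point is a vertex. *)
Definition phase : set (R * R) :=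
  [set z | exists j : side, [/\ on_side j z.1, 0 < z.2 < pi &
     exists2 e : R, 0 < e & forall t : R, 0 < t < e ->
       interior_of (foot j z.1 + t *: direction j z.2)]].

Definition reflect (k : side) (v : R * R) : R * R :=
  v - (2 * dot v (normal k)) *: normal k.

(* The graph of the billiard map: [billiard_map z w] means that S(z) is defined
   and equal to w. *)
Definition billiard_map (z w : R * R) : Prop :=
  [/\ phase z, phase w &
   exists j k : side, [/\ on_side j z.1, on_side k w.1 &
     exists t : R, [/\ 0 < t,
       forall t' : R, 0 < t' < t ->
         interior_of (foot j z.1 + t' *: direction j z.2),
       foot k w.1 = foot j z.1 + t *: direction j z.2,
       forall i : side, foot k w.1 <> vertex i &
       direction k w.2 = reflect k (direction j z.2)]]].

(* S^n(z) is defined and [c] is the sequence of the sides carrying the foot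
   points of z, S(z), ..., S^n(z). *)
Definition coding (n : nat) (z : R * R) (c : n.+1.-tuple side) : Prop :=
  exists x : nat -> R * R,
    [/\ x 0%N = z,
        forall k : nat, (k < n)%N -> billiard_map (x k) (x k.+1) &
        forall k : 'I_n.+1, phase (x k) /\ on_side (tnth c k) (x k).1].

Definition same_coding (n : nat) (z : R * R) : set (R * R) :=
  [set w | exists c : n.+1.-tuple side, coding z c /\ coding w c].

(* The open ball of P_Q for the L_1 metric. *)
Definition ball1 (z : R * R) (e : R) : set (R * R) :=
  [set w | phase w /\ `|z.1 - w.1| + `|z.2 - w.2| < e].

(* The n-cell of z. The relative interior in P_Q is taken because a point whose
   foot is a vertex is coded by only one of the two adjacent sides. *)
Definition cell (n : nat) (z : R * R) : set (R * R) :=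
  [set w | phase w /\ exists2 e : R, 0 < e & ball1 w e `<=` same_coding n z].

(* The Liouville measure sin(theta) dtheta ds on P_Q. *)
Definition liouville (A : set (R * R)) : \bar R :=
  (\int[(@lebesgue_measure R \x @lebesgue_measure R)%E]_(z in A `&` phase)
     (sin z.2)%:E)%E.

Definition dense_in_phase (G : set (R * R)) : Prop :=
  G `<=` phase /\ phase `<=` closure G.

Definition Gdelta_in_phase (G : set (R * R)) : Prop :=
  exists2 A : set (R * R), Gdelta A & G = phase `&` A.

Definition full_measure (G : set (R * R)) : Prop :=
  liouville.-negligible (phase `\` G).

End Billiard.

(* Main.v *)
Require Import Defs.
From mathcomp Require Import all_boot all_order all_algebra.
From mathcomp Require Import all_classical all_reals all_analysis.
From mathcomp Require Import measurable_realfun.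
From mathcomp Require Import ring lra.
Import Order.TTheory GRing.Theory Num.Theory.
Import numFieldNormedType.Exports.
Local Open Scope classical_set_scope.
Local Open Scope ring_scope.
Set Implicit Arguments.
Unset Strict Implicit.
Unset Printing Implicit Defensive.

(** The ball of radius eps about z fails to lie in the n-cell of z only if an
    orbit that starts in it runs into a vertex during its first n flights. Two
    orbits with the same itinerary keep the difference of their angles up to
    sign, and their transversal distance grows at most linearly in time
    ([shadowing]). So there is then a time m < n such that the line of the flight
    that leaves S^m(z) passes within O(m eps) of a vertex. Rays of this kind form a
    set of measure O(m eps), and the measure is invariant; hence the points that
    are bad at time n have measure O(n^2 eps) ([bad_measure]), which is O(1/f(n)) for
    eps = 1/(n^2 f(n)). As f is unbounded, the points that are bad at all large
    times form a null set ([eventually_bad_null]). Doubling the radius turns the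
    good points of time n into a neighbourhood of themselves, so that being good
    infinitely often is a G_delta condition; its density follows from full
    measure.

    Stability. The distance to a vertex is taken to the whole line of a flight.
    The side hit next is determined by the order in which this line crosses the
    sides, and while the line is deformed without touching a vertex the order
    cannot change, because crossing points on different sides never meet
    ([next_crossing_path], [step_stable]).

    Invariance. In the chart (theta, q) with q = s sin theta the Liouville measure
    is the area, and the billiard map from side j to side k is
    (theta, q) |-> (c - theta, b(theta) - q): a reflection in every fibre over a
    reflection of the base, which preserves area by Fubini. Since the map is
    injective, preimages do not gain area ([piecewise_flip_measure],
    [preimage_flip_measure]).

    Topology. For the billiard map to be defined at all points whose line misses
    the vertices, a flight must reach the next side from the left. This is the
    part of the Jordan curve theorem that says that the right of the boundary is
    not enclosed: the right-hand sides of all edges belong to one component, which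
    is followed along the edges and around the vertices ([right_enclosed_all]),
    and a line beyond its last crossing escapes to infinity
    ([arrives_from_left]). *)

(** * Area in the plane *)

Section Area.
Variable R : realType.
Local Notation leb := (@lebesgue_measure R).
Local Notation leb2 := (leb \x leb)%E.

Lemma lebesgue_reflect (c : R) (A : set R) : measurable A ->
  leb ((fun x => c - x) @^-1` A) = leb A.
Proof.
move=> mA.
have mf : measurable_fun [set: R] (fun x : R => c - x) by exact: measurable_funB.
pose m' : {measure set (measurableTypeR R) -> \bar R} :=
  pushforward leb (fun x : measurableTypeR R => (c - x : measurableTypeR R)).
rewrite [RHS](@lebesgue_measure_unique R (m' mf)) // => _ [[a b] _ <-].
rewrite /= /pushforward.
rewrite (_ : _ @^-1` _ = `[c - b, c - a[%classic); last first.
  by apply/seteqP; split=> x /=; rewrite !in_itv /= => /andP[h1 h2]; apply/andP; split; lra.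
rewrite !lebesgue_measure_itv /= !lte_fin.
have -> : (c - b < c - a) = (a < b) by apply/idP/idP; lra.
by case: ifP => // _; rewrite -!EFinB; congr (_%:E); ring.
Qed.

(** Scaling multiplies Lebesgue measure by a constant, by uniqueness on intervals. *)
Lemma lebesgue_scale_null (c : R) (A : set R) : 0 < c -> measurable A ->
  leb A = 0%E -> leb ((fun x => x * c) @^-1` A) = 0%E.
Proof.
move=> c0 mA.
have mf : measurable_fun [set: R] (fun x : R => x * c) by exact: measurable_funM.
pose m' : {measure set (measurableTypeR R) -> \bar R} :=
  mscale (NngNum (ltW c0)) (pushforward leb (fun x : measurableTypeR R => (x * c : measurableTypeR R))).
rewrite [X in X = _ -> _](@lebesgue_measure_unique R (m' mf)) // => [|_ [[a b] _ <-]].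
  rewrite /= /mscale /= /pushforward => /eqP.
  rewrite mule_eq0 => /orP[|/eqP//]; rewrite eqe => /eqP c00.
  by have := c0; rewrite [X in 0 < X]c00 ltxx.
rewrite /= /mscale /= /pushforward.
rewrite (_ : _ @^-1` _ = `]a / c, b / c]%classic); last first.
  by apply/seteqP; split=> x /=; rewrite !in_itv /= ltr_pdivrMr// ler_pdivlMr.
rewrite !lebesgue_measure_itv /= !lte_fin ltr_pM2r ?invr_gt0//.
by case: ifP => // _; rewrite -?EFinB -?EFinM ?mule0//; congr (_%:E); field; lra.
Qed.

(** In every fibre the map is a reflection of the line, so its invariance
    reduces to Fubini and the one-dimensional reflection. *)
Lemma flip_measure (c : R) (b : R -> R) (A : set (R * R)) :
  measurable_fun setT b -> measurable A ->
  measurable ((fun y : R * R => (c - y.1, b y.1 - y.2)) @^-1` A) /\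
  leb2 ((fun y : R * R => (c - y.1, b y.1 - y.2)) @^-1` A) = leb2 A.
Proof.
move=> mb mA.
have mF : measurable_fun [set: R * R] (fun y : R * R => (c - y.1, b y.1 - y.2)).
  apply/measurable_fun_pairP; split => /=.
    by apply: measurable_funB => //.
  by apply: measurable_funB => //; exact: measurableT_comp.
have mP : measurable ((fun y : R * R => (c - y.1, b y.1 - y.2)) @^-1` A).
  by rewrite -[X in measurable X]setTI; exact: mF.
split=> //.
rewrite /product_measure1 /=.
transitivity (\int[leb]_x (leb (xsection A (c - (x : R))%R)))%E.
  apply: eq_integral => x _ /=.
  rewrite -[RHS](lebesgue_reflect (b x)); last exact: measurable_xsection.
  congr (leb _); apply/seteqP; split => y;
  by rewrite /xsection/= !inE /=.
have mg : measurable_fun [set: R] (fun x : R => c - x) by exact: measurable_funB.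
pose m' : {measure set (measurableTypeR R) -> \bar R} :=
  pushforward leb (fun x : measurableTypeR R => (c - x : measurableTypeR R)).
transitivity (\int[m' mg]_x (leb (xsection A x)))%E.
  rewrite (@ge0_integral_pushforward _ _ _ _ _ (fun x : measurableTypeR R => (c - x : measurableTypeR R)) mg leb setT) //.
  exact: measurable_fun_xsection.
apply: eq_measure_integral => B mB _; exact: lebesgue_reflect.
Qed.

Lemma le_measure_plane (A B : set (R * R)) : measurable A -> measurable B ->
  A `<=` B -> (leb2 A <= leb2 B)%E.
Proof. by move=> mA mB AB; apply: le_measure; rewrite ?inE. Qed.

Lemma null_measure_sub (A B : set (R * R)) : measurable A -> measurable B ->
  A `<=` B -> leb2 B = 0%E -> leb2 A = 0%E.
Proof.
move=> mA mB AB B0; apply/eqP; rewrite eq_le measure_ge0 andbT -B0.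
exact: le_measure_plane.
Qed.

(** Almost every fibre of a null set is null, and scaling a fibre by the nonzero
    [g] keeps it null. With [g := sin] this carries null sets from the chart
    [to_chart] back to the coordinates (s, theta). *)
Lemma null_unscale (g : R -> R) (W : set (R * R)) :
  measurable_fun setT g -> measurable W -> leb2 W = 0%E ->
  let N := [set z : R * R | 0 < g z.2 /\ W (z.2, z.1 * g z.2)] in
  measurable N /\ leb2 N = 0%E.
Proof.
move=> mg mW W0 N.
have mF : measurable_fun [set: R * R] (fun z : R * R => (z.2, z.1 * g z.2)).
  apply: measurable_fun_pair => //.
  by apply: measurable_funM => //; exact: measurableT_comp.
have mN : measurable N.
  have -> : N = (g \o snd) @^-1` `]0, +oo[%classic `&`
      (fun z : R * R => (z.2, z.1 * g z.2)) @^-1` W.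
    by apply/seteqP; split=> z /=; rewrite /N /= in_itv /= andbT.
  apply: measurableI; rewrite -[X in measurable X]setTI; last exact: mF.
  have : measurable_fun [set: R * R] (g \o snd) by exact: measurableT_comp.
  by apply => //; exact: measurable_itv.
split=> //.
have Wae : ae_eq leb setT (leb \o xsection W) (cst 0%E).
  apply/ae_eq_integral_abs => //; first exact: measurable_fun_xsection.
  by rewrite -[RHS]W0; apply: eq_integral => x _ /=; rewrite gee0_abs.
rewrite (@product_measure_unique _ _ _ _ _ leb leb (leb \x^ leb)%E) //; last first.
  by move=> A B mA mB; rewrite -product_measure2E.
rewrite /= /product_measure2.
rewrite -[RHS](@integral0 _ _ _ leb setT).
apply: ge0_ae_eq_integral => //; first exact: measurable_fun_ysection.
apply: filterS Wae => x /(_ I) /= Wx _.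
have [gx|gx] := ltP 0 (g x).
  rewrite (_ : ysection N x = (fun s => s * g x) @^-1` xsection W x).
    by apply: lebesgue_scale_null => //; exact: measurable_xsection.
  apply/seteqP; split=> s /=; rewrite /ysection/xsection/N/= !inE /=.
    by case.
  by [].
rewrite (_ : ysection N x = set0) ?measure0//.
by apply/seteqP; split=> s //=; rewrite /ysection/N/= inE /= => -[]; rewrite ltNge gx.
Qed.

(** Each piece of the preimage is moved into [A] without change of area, and
    injectivity makes the moved pieces disjoint. *)
Lemma piecewise_flip_measure (I : finType) (O : I -> set (R * R))
    (c : I -> R) (b : I -> R -> R) (A : set (R * R)) :
  let F := fun i (y : R * R) => (c i - y.1, b i y.1 - y.2) in
  (forall i, measurable (O i)) -> (forall i, measurable_fun setT (b i)) ->
  (forall i j y y', O i y -> O j y' -> F i y = F j y' -> i = j) ->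
  measurable A ->
  let P := [set y | exists i, O i y /\ A (F i y)] in
  measurable P /\ (leb2 P <= leb2 A)%E.
Proof.
move=> F mO mb inj mA P.
pose G i (y : R * R) := (c i - y.1, b i (c i - y.1) - y.2).
have FG i y : F i (G i y) = y.
  by rewrite /F /G /=; case: y => y1 y2 /=; congr pair; ring.
have GF i y : G i (F i y) = y.
  rewrite /F /G /=; case: y => y1 y2 /=.
  by rewrite subKr; congr pair; ring.
have mb' i : measurable_fun setT (fun x : R => b i (c i - x)).
  by apply: (measurableT_comp (mb i)); exact: measurable_funB.
pose J i := G i @^-1` O i `&` A.
have mJ i : measurable (J i).
  by apply: measurableI => //; have [] := flip_measure (c i) (mb' i) (mO i).
have mK i : measurable (O i `&` F i @^-1` A).
  by apply: measurableI => //; have [] := flip_measure (c i) (mb i) mA.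
have fI : finite_set [set: I] by exact: finite_finset.
have PE : P = \bigcup_(i in setT) (O i `&` F i @^-1` A).
  by apply/seteqP; split=> y [i]; [exists i|move=> _ ?; exists i].
have mP : measurable P by rewrite PE; exact: fin_bigcup_measurable.
split=> //.
apply: (@le_trans _ _ (\sum_(i \in setT) leb2 (O i `&` F i @^-1` A))%E).
  by apply: content_sub_fsum => // [i _|]; [exact: mK|rewrite PE].
rewrite (eq_fsbigr (fun i => leb2 (J i))); last first.
  move=> i _; have [_ <-] := flip_measure (c i) (mb i) (mJ i).
  congr (leb2 _); apply/seteqP; split=> y.
    by move=> [Oy Ay]; split=> //; rewrite /= GF.
  by move=> [/=]; rewrite GF.
have tJ : trivIset setT J.
  apply/trivIsetP => i j _ _ ij; apply/seteqP; split=> // y [[Oi _] [Oj _]].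
  by move/eqP: ij; apply; apply: (inj _ _ _ _ Oi Oj); rewrite !FG.
have mU : measurable (\bigcup_(i in setT) J i) by exact: fin_bigcup_measurable.
have <- : leb2 (\bigcup_(i in setT) J i) = (\sum_(i \in setT) leb2 (J i))%E.
  by apply: measure_fin_bigcup => // i _; exact: mJ.
by apply: le_measure_plane => // y [i _ []].
Qed.

(** An open set is the union of the countably many rational squares inside it. *)
Lemma open_measurable_plane (U : set (R * R)) : open U -> measurable U.
Proof.
move=> oU.
pose sq (p : rat * rat * nat) : set (R * R) :=
  ball (ratr p.1.1 : R) (p.2.+1%:R^-1) `*` ball (ratr p.1.2 : R) (p.2.+1%:R^-1).
pose S n : set (R * R) := if unpickle n is Some p then
  (if `[< sq p `<=` U >] then sq p else set0) else set0.
have -> : U = \bigcup_n S n.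
  apply/seteqP; split=> [y Uy|y [n _]]; last first.
    by rewrite /S; case: unpickle => [p|//]; case: ifP => // /asboolP h /h.
  have /nbhs_ballP[e /= e0 eU] : nbhs y U by exact: open_nbhs_nbhs.
  have [k ke] : exists k : nat, k.+1%:R^-1 < e / 2.
    have e20 : 0 < e / 2 by rewrite divr_gt0.
    exists (Num.truncn (e / 2)^-1); rewrite invf_plt ?posrE ?ltr0n//.
    exact: truncnS_gt.
  have k0 : 0 < k.+1%:R^-1 :> R by rewrite invr_gt0 ltr0n.
  set d : R := k.+1%:R^-1 in ke k0.
  have [q1] : exists q : rat, ratr q \in `]y.1 - d, y.1 + d[.
    by apply: rat_in_itvoo; lra.
  rewrite in_itv /= => /andP[q11 q12].
  have [q2] : exists q : rat, ratr q \in `]y.2 - d, y.2 + d[.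
    by apply: rat_in_itvoo; lra.
  rewrite in_itv /= => /andP[q21 q22].
  have [n nE] : exists n, unpickle n = Some (q1, q2, k).
    by eexists; exact: pickleK.
  exists n => //; rewrite /S nE.
  have -> : `[< sq (q1, q2, k) `<=` U >].
    apply/asboolP => z [] /=; rewrite /ball /= -/d => z1 z2; apply: eU.
    by split; rewrite /= /ball /=; move: z1 z2; rewrite !ltr_norml => /andP[? ?] /andP[? ?]; lra.
  by split; rewrite /= /ball /= -/d ltr_norml; lra.
apply: bigcupT_measurable => n; rewrite /S; case: unpickle => [p|//].
case: ifP => // _; apply: measurableX; exact: measurable_ball.
Qed.

(** The band is the flipped image of a rectangle. *)
Lemma band_measure (b : R -> R) (a d : R) : 0 <= a -> 0 <= d ->
  measurable_fun setT b ->
  let D := [set y : R * R | 0 <= y.1 <= a /\ `|b y.1 - y.2| <= d] in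
  measurable D /\ leb2 D = (a * (2 * d))%:E.
Proof.
move=> a0 d0 mb D.
have mQ : measurable (`[0, a]%classic `*` `[- d, d]%classic : set (R * R)).
  by apply: measurableX; exact: measurable_itv.
have [mD eD] := flip_measure a mb mQ.
have -> : D = (fun y : R * R => (a - y.1, b y.1 - y.2)) @^-1`
   (`[0, a]%classic `*` `[- d, d]%classic).
  apply/seteqP; split=> y; rewrite /D /= !in_itv /= ler_norml.
    by move=> [/andP[? ?] ->]; split=> //; lra.
  by move=> [/andP[? ?] ->]; split=> //; lra.
split=> //; rewrite eD product_measure1E; [|exact: measurable_itv..].
have len x y : leb `[x, y]%classic = if x < y then (y - x)%:E else 0%E.
  by rewrite lebesgue_measure_itv /= lte_fin EFinB.
transitivity (leb `[0%R, a]%classic * leb `[(- d)%R, d]%classic)%E => //.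
rewrite !len.
case: ltP => [_|ha]; case: ltP => [_|hd]; rewrite -?EFinB -?EFinM ?mule0 ?mul0e; congr (_%:E); try nra.
Qed.

End Area.

Section NullIntegral.
Import HBNNSimple.

(** A simple function below [f] on [D] vanishes off the null set [A], so its
    integral is zero, and the integral of [f] is a supremum of such values. *)
Lemma null_integral d (X : measurableType d) (R : realType)
    (mu : {measure set X -> \bar R}) (D A : set X) (f : X -> \bar R) :
  measurable A -> mu A = 0%E -> D `<=` A -> (forall x, D x -> (0 <= f x)%E) ->
  (\int[mu]_(x in D) f x = 0)%E.
Proof.
move=> mA A0 DA f0; apply/eqP; rewrite eq_le integral_ge0// andbT ge0_integralE//.
apply/ge_ereal_sup => /= _ [h hf <-]; rewrite sintegralET fsbig1// => r _ /=.
have [->|r0] := eqVneq r 0; first by rewrite mul0e.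
rewrite (_ : mu _ = 0%E) ?mule0//; apply/eqP; rewrite eq_le measure_ge0 andbT -A0.
apply: le_measure; rewrite ?inE// => x /= hx; apply: DA.
have := hf x; rewrite patchE; case: ifPn => [|_]; first by rewrite inE.
rewrite hx lee_fin => rle; exfalso; move/eqP: r0; apply; apply/eqP.
by rewrite eq_le rle -hx fun_ge0.
Qed.

End NullIntegral.

(** * Real numbers and real functions *)

Section RealFunctions.
Variable R : realType.

Lemma convex_lt (a b r t : R) : a < r -> b < r -> 0 <= t <= 1 ->
  a + t * (b - a) < r.
Proof.
move=> ar br /andP[t0 t1]; have [t1'|t1'] := ltP t 1; last first.
  by have -> : t = 1; lra.
have : 0 < (1 - t) * (r - a) by rewrite mulr_gt0// subr_gt0.
have : 0 <= t * (r - b) by rewrite mulr_ge0// subr_ge0 ltW.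
by nra.
Qed.

Lemma finite_bound (I : finType) (F : I -> R) : exists2 M, 0 <= M & forall i, F i <= M.
Proof.
exists (\sum_i `|F i|); first exact: sumr_ge0.
move=> i; apply: le_trans (ler_norm _) _; rewrite (bigD1 i) //= lerDl.
exact: sumr_ge0.
Qed.

Lemma pos_lower_bound (s : seq R) : all (fun x : R => 0 < x) s ->
  exists2 e, 0 < e & all (fun x : R => e < x) s.
Proof.
elim: s => [|x s IH] /=; first by exists 1.
move=> /andP[x0 /IH[e e0 he]]; pose m := Num.min e x.
have m0 : 0 < m by rewrite lt_min e0.
have [me mx] : m <= e /\ m <= x by rewrite !ge_min !lexx orbT.
exists (m / 2); first by rewrite divr_gt0.
apply/andP; split; first by lra.
by apply: sub_all he => y; apply: le_lt_trans; lra.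
Qed.

(** An open interval is connected, and [P] cuts out a subset of it that is both
    relatively open and relatively closed. *)
Lemma locally_constant_itv (a b : R) (P : R -> Prop) :
  (forall x : R, a < x < b -> exists2 e, 0 < e &
     forall y : R, a < y < b -> `|x - y| < e -> (P x <-> P y)) ->
  forall x y : R, a < x < b -> a < y < b -> P x -> P y.
Proof.
move=> loc x y xab yab Px.
have cA : connected `]a, b[%classic by apply/connected_intervalP; exact: interval_is_interval.
have nearP (z : R) : a < z < b -> \forall w \near z, P w <-> P z.
  move=> zab; have [e e0 he] := loc z zab; case/andP: (zab) => az zb.
  apply/nbhs_ballP; exists (Num.min e (Num.min (z - a) (b - z))) => /=.
    by rewrite !lt_min e0 !subr_gt0 az zb.
  move=> w; rewrite /ball /= !lt_min => /and3P[ze]; rewrite !ltr_norml => w1 w2.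
  by have [] := he w _ ze => //; lra.
have : `]a, b[%classic `&` [set z | P z] = `]a, b[%classic; last first.
  by move/seteqP => [_] /(_ y) /=; rewrite in_itv /= => /(_ yab)[].
apply: cA.
- by exists x; split => //=; rewrite in_itv.
- exists ([set z | P z]°); first exact: open_interior.
  apply/seteqP; split=> z [zab] Pz; split=> //; last exact: interior_subset Pz.
  by move: zab; rewrite /= in_itv /= => /nearP; apply: filterS => w wz; apply/wz.
- exists (~` ([set z | ~ P z]°)); first exact/open_closedC/open_interior.
  apply/seteqP; split=> z [zab] Pz; split=> //.
    by move=> /interior_subset.
  apply: contrapT => nPz; apply: Pz.
  by move: zab; rewrite /= in_itv /= => /nearP; apply: filterS => w wz; move/wz.
Qed.

(** Intermediate value theorem. *)
Lemma nonvanishing_same_sign (g : R -> R) : continuous g ->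
  (forall t, 0 <= t <= 1 -> g t <> 0) -> 0 < g 0 * g 1.
Proof.
move=> cg g0; rewrite ltNge; apply/negP => le0.
have [|t] := @IVT R g 0 1 0 ler01 (continuous_subspaceT cg).
  rewrite ge_min le_max; apply/andP; split; apply/negPn; rewrite negb_or -!ltNge;
    by apply/negP => /andP[a0 b0]; move: le0; rewrite leNgt => /negP; apply; nra.
by rewrite in_itv /= => /g0.
Qed.

Lemma derivable_lipschitz1 (g dg : R -> R) : (forall x : R, is_derive x 1 g (dg x)) ->
  (forall x : R, `|dg x| <= 1) -> forall a b, `|g a - g b| <= `|a - b|.
Proof.
move=> hg bg a b; wlog ab : a b / a < b.
  move=> W; case: (ltgtP a b) => [|ba|->]; [exact: W| |by rewrite !subrr].
  by rewrite distrC [leRHS]distrC; exact: W.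
have [|c _ e] := @MVT R g dg a b ab (fun x _ => hg x).
  by apply: derivable_within_continuous => x _; have [] := hg x.
by rewrite distrC e [leRHS]distrC normrM ler_piMl.
Qed.

Lemma cos_lipschitz (a b : R) : `|cos a - cos b| <= `|a - b|.
Proof.
apply: (@derivable_lipschitz1 _ (fun x : R => - sin x)) => x.
by rewrite normrN; rewrite ler_norml sin_geN1 sin_le1.
Qed.

Lemma sin_lipschitz (a b : R) : `|sin a - sin b| <= `|a - b|.
Proof.
by apply: (@derivable_lipschitz1 _ cos) => x; rewrite ler_norml cos_geN1 cos_le1.
Qed.

Lemma trig_lipschitz (A B C g a b : R) :
  `|(A * cos a + B * sin a + C * sin (g - a)) - (A * cos b + B * sin b + C * sin (g - b))|
    <= (`|A| + `|B| + `|C|) * `|a - b|.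
Proof.
have -> : (A * cos a + B * sin a + C * sin (g - a)) - (A * cos b + B * sin b + C * sin (g - b))
  = A * (cos a - cos b) + B * (sin a - sin b) + C * (sin (g - a) - sin (g - b)) by ring.
rewrite !mulrDl.
apply: le_trans (ler_normD _ _) _; apply: lerD; last first.
  rewrite normrM ler_wpM2l//; apply: le_trans (sin_lipschitz _ _) _.
  by rewrite (_ : g - a - (g - b) = b - a) 1?distrC//; ring.
apply: le_trans (ler_normD _ _) _; apply: lerD; rewrite normrM ler_wpM2l//.
  exact: cos_lipschitz.
exact: sin_lipschitz.
Qed.

Lemma measurable_trig (A B C g : R) :
  measurable_fun setT (fun a : R => A * cos a + B * sin a + C * sin (g - a)).
Proof.
apply: continuous_measurable_fun => a.
have cg : {for a, continuous (fun a : R => sin (g - a))}.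
  apply: (@continuous_comp _ _ _ (fun a : R => g - a) sin); last exact: continuous_sin.
  by apply: cvgB; [exact: cvg_cst|exact: cvg_id].
by do !(first [exact: cvg_cst|exact: continuous_cos|exact: continuous_sin|exact: cg|apply: cvgD|apply: cvgM]).
Qed.

(** The polar angle of a unit vector, taken in the interval from 0 to 2 pi. *)
Definition polar (a b : R) : R := if 0 <= b then acos a else 2 * pi - acos a.

Lemma polarP (a b : R) : a ^+ 2 + b ^+ 2 = 1 ->
  [/\ 0 <= polar a b < 2 * pi, cos (polar a b) = a & sin (polar a b) = b].
Proof.
move=> ab; have p0 := pi_gt0 R.
have a1 : -1 <= a <= 1 by have := sqr_ge0 b; rewrite !expr2 => b2; rewrite !expr2 in ab; apply/andP; split; nra.
have sa : sin (acos a) = `|b|.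
  by rewrite sin_acos// -ab addrAC subrr add0r sqrtr_sqr.
have ca : cos (acos a) = a by apply: acosK; rewrite in_itv.
rewrite /polar; case: (leP 0 b) => b0.
  split; [|exact: ca|by rewrite sa ger0_norm].
  by have := acos_ge0 a1; have := acos_lepi a1; lra.
have am : 0 < acos a.
  rewrite lt_neqAle acos_ge0// andbT; apply/eqP => e.
  by move: sa; rewrite -e sin0 => /esym/eqP; rewrite normr_eq0 lt_eqF.
have e : 2 * pi - acos a = - acos a + pi *+ 2 by rewrite mulr_natl addrC.
rewrite e cosD2pi sinD2pi cosN sinN sa ltr0_norm// opprK; split=> //.
by have := acos_lepi a1; rewrite -e; lra.
Qed.

(** On each side of (0, pi) the sine is nonpositive for another full half-turn. *)
Lemma sin_gt0_range (a : R) : - pi < a < 2 * pi -> 0 < sin a -> 0 < a < pi.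
Proof.
move=> /andP[a1 a2] sa; apply/andP; split; rewrite ltNge; apply/negP => h.
  have : 0 <= sin (- a) by apply: sin_ge0_pi; lra.
  by rewrite sinN; lra.
have : 0 <= sin (a - pi) by apply: sin_ge0_pi; lra.
by rewrite sinB cospi sinpi; lra.
Qed.

End RealFunctions.

Lemma increasing_choice (P : nat -> Prop) : (forall N, exists2 n, (N <= n)%N & P n) ->
  exists u : nat -> nat, (forall i j, (i < j)%N -> (u i < u j)%N) /\ forall i, P (u i).
Proof.
move=> hP; have [g hg] : {g : nat -> nat & forall N, (N <= g N)%N /\ P (g N)}.
  apply: (@choice _ _ (fun N n => (N <= n)%N /\ P n)) => N; have [n nN Pn] := hP N.
  by exists n.
exists (fun i => iter i (fun m => g m.+1) (g 0%N)); split=> [i j|[|i]]; last 2 first.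
- exact: (hg 0%N).2.
- exact: (hg _).2.
elim: j => // j IH; rewrite ltnS leq_eqVlt => /orP[/eqP ->|/IH ij] /=.
  exact: (hg _).1.
by apply: ltn_trans ij _; exact: (hg _).1.
Qed.

(** * Plane vectors *)

Section Vectors.
Variable R : realType.
Implicit Types (x y h d : R * R) (r t : R).

Definition cross x y : R := x.1 * y.2 - x.2 * y.1.

Lemma crossD x y h : cross x (y + h) = cross x y + cross x h.
Proof. by rewrite /cross /= /GRing.scale /=; ring. Qed.

Lemma crossZ x t y : cross x (t *: y) = t * cross x y.
Proof. by rewrite /cross /= /GRing.scale /=; ring. Qed.

Lemma crossxx x : cross x x = 0.
Proof. by rewrite /cross; ring. Qed.

Lemma cross_convex x h h' t : 0 <= t <= 1 ->
  cross x h < 0 -> cross x h' < 0 -> cross x (h + t *: (h' - h)) < 0.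
Proof.
move=> t01 h0 h1; have -> : cross x (h + t *: (h' - h)) = cross x h + t * (cross x h' - cross x h).
  by rewrite /cross /= /GRing.scale /=; ring.
exact: convex_lt.
Qed.

(** A sup-norm box rather than a disc: it is the shape of the neighbourhoods in
    the product topology, and it is convex. *)
Definition small r h := `|h.1| < r /\ `|h.2| < r.

Lemma nbhs_small x (U : set (R * R)) : nbhs x U ->
  exists2 r, 0 < r & forall h, small r h -> U (x + h).
Proof.
move=> /nbhs_ballP[r /= r0 xU]; exists r => // h [h1 h2]; apply: xU.
by split; rewrite /= /ball /= opprD addNKr normrN.
Qed.

Lemma smallZ r h (t : R) : 0 < r -> 0 <= t -> t * (`|h.1| + `|h.2| + 1) < r -> small r (t *: h).
Proof.
move=> r0 t0 tr; have h1 := normr_ge0 h.1; have h2 := normr_ge0 h.2.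
by split; rewrite /= normrM (ger0_norm t0); nra.
Qed.

Lemma small_shrink r h : 0 < r ->
  exists2 e, 0 < e & forall t, 0 <= t < e -> small r (t *: h).
Proof.
move=> r0; have h1 := normr_ge0 h.1; have h2 := normr_ge0 h.2.
have s0 : 0 < `|h.1| + `|h.2| + 1 by lra.
exists (r / (`|h.1| + `|h.2| + 1)); first by rewrite divr_gt0.
by move=> t /andP[t0]; rewrite ltr_pdivlMr// => tr; exact: smallZ.
Qed.

Lemma small_convex r h h' (t : R) : small r h -> small r h' -> 0 <= t <= 1 ->
  small r (h + t *: (h' - h)).
Proof.
move=> [h1 h2] [h3 h4] t01.
split => /=; move: h1 h2 h3 h4; rewrite !ltr_norml => /andP[? ?] /andP[? ?] /andP[? ?] /andP[? ?];
  rewrite convex_lt// andbT -ltrN2 opprK.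
- have -> : - (h.1 + t * (h'.1 - h.1)) = - h.1 + t * (- h'.1 - (- h.1)) by ring.
  by apply: convex_lt => //; lra.
- have -> : - (h.2 + t * (h'.2 - h.2)) = - h.2 + t * (- h'.2 - (- h.2)) by ring.
  by apply: convex_lt => //; lra.
Qed.

Lemma smallD r h h' : small (r / 2) h -> small (r / 2) h' -> small r (h + h').
Proof.
move=> [h1 h2] [h3 h4].
by split => /=; apply: le_lt_trans (ler_normD _ _) _; lra.
Qed.

Lemma small_le r r' h : r <= r' -> small r h -> small r' h.
Proof. by move=> rr [h1 h2]; split; apply: lt_le_trans rr. Qed.

Lemma line_continuous x d : continuous (fun t : R => x + t *: d).
Proof.
by move=> t; apply: cvgD; [exact: cvg_cst|apply: cvgZr_tmp; exact: cvg_id].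
Qed.

Lemma segment_offset x h h' t : (x + h) + t *: ((x + h') - (x + h)) = x + (h + t *: (h' - h)).
Proof. by rewrite -addrA opprD addrACA subrr add0r. Qed.

Lemma unit_neq0 d : dot d d = 1 -> d <> 0.
Proof. by move=> d1 d0; move: d1; rewrite d0 /dot /= !mul0r addr0 => /esym/eqP; rewrite oner_eq0. Qed.

(** The line with unit direction [d] at signed distance [c] from the origin is the
    zero set of this affine function. *)
Definition line_height d c x : R := cross x d - c.

Local Notation H := line_height.

Lemma heightD d c x t y : H d c (x + t *: y) = H d c x + t * cross y d.
Proof. by rewrite /H /cross /= /GRing.scale /=; ring. Qed.

Lemma on_line d c x y : dot d d = 1 -> H d c x = 0 -> H d c y = 0 ->
  y = x + (dot y d - dot x d) *: d.
Proof.
move=> d1 /subr0_eq hx /subr0_eq hy.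
have h : cross y d = cross x d by rewrite hx hy.
have dd t : t = t * dot d d by rewrite d1 mulr1.
apply: injective_projections => /=; rewrite /GRing.scale /=; apply/eqP; rewrite -subr_eq0; apply/eqP.
- transitivity ((y.1 - x.1) * (1 - dot d d) + d.2 * (cross y d - cross x d)).
    by rewrite /dot /cross; ring.
  by rewrite d1 h !subrr !mulr0 addr0.
- transitivity ((y.2 - x.2) * (1 - dot d d) - d.1 * (cross y d - cross x d)).
    by rewrite /dot /cross; ring.
  by rewrite d1 h !subrr !mulr0 subr0.
Qed.

Lemma dist_open (z : R * R) (e : R) : open [set w : R * R | `|z.1 - w.1| + `|z.2 - w.2| < e].
Proof.
apply: (@open_comp _ _ (fun w : R * R => `|z.1 - w.1| + `|z.2 - w.2|) [set x | x < e]); last exact: open_lt.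
move=> w _; apply: cvgD; apply: cvg_norm; apply: cvgB; [exact: cvg_cst|exact: cvg_fst|exact: cvg_cst|exact: cvg_snd].
Qed.

End Vectors.

(** * Sides of a polygon *)

Section Polygon.
Variables (R : realType) (Q : polygon R).
Local Notation side := ('I_(nsides Q)).
Local Notation vtx := (@vertex R Q).
Local Notation len := (@side_length R Q).
Local Notation arc := (@arc_start R Q).
Local Notation T := (@tangent R Q).
Local Notation dir := (@direction R Q).
Local Notation pline := (polyline vtx).
Local Notation encl := (enclosed vtx).
Local Notation H := (@line_height R).
Local Notation leb := (@lebesgue_measure R).
Local Notation leb2 := (leb \x leb)%E.
Implicit Types (i j k : side) (u t r c : R) (x y h d : R * R).

(** The point at arc length [u] along side [j], so that [foot j s] is
    [pt j (s - arc j)]. *)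
Definition pt j u : R * R := vtx j + u *: T j.

Lemma side_vec_neq0 j : vtx (ordS j) - vtx j <> 0.
Proof.
move=> e0.
have := @simple R Q j j 0 2^-1; rewrite /side_point e0 !scaler0 => H.
by have [] : j = j /\ 0 = 2^-1 :> R; [apply: H => //; lra|move=> _; lra].
Qed.

Lemma side_length_sqr j :
  len j ^+ 2 = (vtx (ordS j) - vtx j).1 ^+ 2 + (vtx (ordS j) - vtx j).2 ^+ 2.
Proof.
by rewrite /side_length /enorm /dot sqr_sqrtr -!expr2 ?addr_ge0 ?sqr_ge0.
Qed.

Lemma side_length_gt0 j : 0 < len j.
Proof.
rewrite lt_neqAle sqrtr_ge0 andbT eq_sym; apply/eqP => L0.
have := side_length_sqr j; rewrite L0 expr0n /= => /esym/eqP.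
rewrite paddr_eq0 ?sqr_ge0// !sqrf_eq0 => /andP[/eqP e1 /eqP e2].
apply: (@side_vec_neq0 j).
exact: injective_projections.
Qed.

Lemma side_vecE j : vtx (ordS j) - vtx j = len j *: T j.
Proof. by rewrite /tangent scalerA divff ?scale1r// gt_eqF ?side_length_gt0. Qed.

Lemma vtx_next i : vtx (ordS i) = vtx i + len i *: T i.
Proof. by rewrite -side_vecE addrC subrK. Qed.

Lemma tangent_unit j : (T j).1 ^+ 2 + (T j).2 ^+ 2 = 1.
Proof.
have L0 := side_length_gt0 j; have := side_length_sqr j; rewrite side_vecE /=.
by rewrite !exprMn -mulrDr -{1}[len j ^+ 2]mulr1 => /mulfI ->//; rewrite expf_neq0// gt_eqF.
Qed.

Lemma cross_rot90 j : cross (T j) (rot90 (T j)) = 1.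
Proof. by rewrite -(tangent_unit j) /cross /rot90 /=; ring. Qed.

Lemma tangent_le1 j : `|(T j).1| <= 1 /\ `|(T j).2| <= 1.
Proof.
have := tangent_unit j; have := sqr_ge0 (T j).1; have := sqr_ge0 (T j).2.
by rewrite !expr2 => h1 h2 h; rewrite !ler_norml; split; apply/andP; split; nra.
Qed.

Lemma small_tangent (r : R) j t : `|t| < r -> small r (t *: T j).
Proof.
have [h1 h2] := tangent_le1 j => tr.
by split; rewrite /= normrM; apply: le_lt_trans tr; rewrite ler_piMr.
Qed.

Lemma small_normal (r : R) j t : `|t| < r -> small r (t *: rot90 (T j)).
Proof.
have [h1 h2] := tangent_le1 j => tr.
by split; rewrite /= normrM ?normrN; apply: le_lt_trans tr; rewrite ler_piMr.
Qed.

Lemma side_pointE j (a : R) : side_point vtx j a = pt j (a * len j).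
Proof. by rewrite /side_point side_vecE scalerA. Qed.

Lemma pt0 j : pt j 0 = vtx j. Proof. by rewrite /pt scale0r addr0. Qed.

Lemma pt_end j : pt j (len j) = vtx (ordS j).
Proof. by rewrite /pt -side_vecE addrC subrK. Qed.

Lemma pt_end_shift j u : pt j u = vtx (ordS j) - (len j - u) *: T j.
Proof. by rewrite -pt_end /pt -addrA -scalerBl; congr (_ + _ *: _); ring. Qed.

Lemma ptD j u t : pt j (u + t) = pt j u + t *: T j.
Proof. by rewrite /pt scalerDl addrA. Qed.

Lemma pt_inj i j u t : 0 <= u < len i -> 0 <= t < len j -> pt i u = pt j t ->
  i = j /\ u = t.
Proof.
move=> ui tj e; have Li := side_length_gt0 i; have Lj := side_length_gt0 j.
have frac k (w : R) : 0 <= w < len k -> 0 <= w / len k < 1.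
  by move=> /andP[w0 wk]; rewrite ltr_pdivrMr ?side_length_gt0// mul1r wk divr_ge0// ltW// side_length_gt0.
have := @simple R Q i j (u / len i) (t / len j) (frac _ _ ui) (frac _ _ tj).
rewrite !side_pointE !divfK ?gt_eqF// => /(_ e) [ij utE]; subst j; split=> //.
by have /(congr1 (fun z => z * len i)) := utE; rewrite !divfK ?gt_eqF.
Qed.

Lemma ordS_neq j : ordS j <> j.
Proof. by move=> e; apply: (@side_vec_neq0 j); rewrite e subrr. Qed.

Lemma ordS_inj i j : ordS i = ordS j -> i = j.
Proof. exact: (can_inj (@ordSK _)). Qed.

(** The far end of a closed side is the initial point of the next side, which
    reduces the claim to half-open sides. *)
Lemma open_pt_inj i j u t : 0 < u < len i -> 0 <= t <= len j -> pt i u = pt j t ->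
  i = j /\ u = t.
Proof.
move=> /andP[u0 ui] /andP[t0]; rewrite le_eqVlt => /orP[/eqP ->|tj] e; last first.
  by apply: pt_inj => //; lra.
move: e; rewrite pt_end -pt0 => e.
have [] := @pt_inj i (ordS j) u 0 _ _ e; rewrite ?lexx ?side_length_gt0//; lra.
Qed.

Lemma vtx_on_side i j t : 0 <= t <= len i -> vtx j = pt i t ->
  (i = j /\ t = 0) \/ (ordS i = j /\ t = len i).
Proof.
have z k : 0 <= (0 : R) < len k by rewrite lexx side_length_gt0.
move=> /andP[t0]; rewrite le_eqVlt => /orP[/eqP ->|ti] e; [right|left].
  have e' : pt (ordS i) 0 = pt j 0 by rewrite !pt0 -pt_end.
  by have [] := pt_inj (z _) (z _) e'.
have e' : pt i t = pt j 0 by rewrite pt0.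
have ti' : 0 <= t < len i by rewrite t0.
by have [] := pt_inj ti' (z _) e'.
Qed.

Lemma not_antiparallel j : T (ordS j) <> - T j.
Proof.
move=> e; have L0 := side_length_gt0 j; have L1 := side_length_gt0 (ordS j).
pose t := Num.min (len j) (len (ordS j)) / 2.
have t0 : 0 < t by rewrite divr_gt0// lt_min L0.
have [t1 t2] : t < len j /\ t < len (ordS j).
  have : t < Num.min (len j) (len (ordS j)).
    by rewrite ltr_pdivrMr// mulr2n mulrDr mulr1 ltrDl lt_min L0.
  by rewrite lt_min => /andP[].
have eq : pt (ordS j) t = pt j (len j - t).
  by rewrite [RHS]pt_end_shift /pt e scalerN subKr.
have [] := @open_pt_inj (ordS j) j t (len j - t) _ _ eq; [lra|lra|].
by move=> /ordS_neq.
Qed.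

Lemma polylineP x : polyline vtx x <-> exists j u, 0 <= u <= len j /\ x = pt j u.
Proof.
split=> [[j [a [/andP[a0 a1] ->]]]|[j [u [/andP[u0 uL] ->]]]]; have L0 := side_length_gt0 j.
  exists j, (a * len j); rewrite side_pointE; split=> //; nra.
exists j, (u / len j); rewrite side_pointE divfK ?gt_eqF//; split=> //.
by rewrite ler_pdivrMr// mul1r uL divr_ge0// ltW.
Qed.

(** Finitely many compact sides have a closed union. *)
Lemma avoid_sides (P : pred side) x :
  (forall i u, P i -> 0 <= u <= len i -> x <> pt i u) ->
  exists2 r, 0 < r &
    forall h, small r h -> forall i u, P i -> 0 <= u <= len i -> x + h <> pt i u.
Proof.
move=> Px.
have nearx : \forall y \near nbhs x, forall i, P i ->
    ~ (exists u, 0 <= u <= len i /\ y = pt i u).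
  apply: filter_forall => i.
  have [Pi|nPi] := boolP (P i); last by near=> y.
  have cK : closed [set pt i u | u in `[0, len i]%classic].
    apply: compact_closed; first exact: norm_hausdorff.
    apply: continuous_compact; last exact: segment_compact.
    apply: continuous_subspaceT => u.
    by apply: cvgD; [exact: cvg_cst|apply: cvgZr_tmp; exact: cvg_id].
  have : nbhs x (~` [set pt i u | u in `[0, len i]%classic]).
    apply: open_nbhs_nbhs; split; first exact: closed_openC.
    by move=> [u]; rewrite /= in_itv /= => ui xE; exact: (Px i u Pi ui).
  apply: filterS => y ny _ [u [ui yE]]; apply: ny; exists u; rewrite ?yE //= in_itv.
have [r r0 hr] := nbhs_small nearx; exists r => // h hh i u Pi ui e.
by apply: (hr h hh i Pi); exists u.
Unshelve. all: by end_near.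
Qed.

(** * The left and the right of the boundary *)

(** The segment is connected, so its ends lie in the same component. *)
Lemma enclosed_segment x y :
  (forall t, 0 <= t <= 1 -> ~ pline (x + t *: (y - x))) -> encl x -> encl y.
Proof.
move=> xy [nx bx].
have ny : ~ pline y by have := xy 1; rewrite scale1r addrC subrK; apply; rewrite lexx ler01.
split=> //.
rewrite -(@same_connected_component _ _ x y) //.
apply: (@connected_component_max _ _ [set x + t *: (y - x) | t in `[0, 1]%classic]).
- by exists 0; rewrite ?scale0r ?addr0//= in_itv /= lexx ler01.
- by move=> _ [t + <-]; rewrite /= in_itv /= => /xy.
- apply: connected_continuous_connected; first exact: segment_connected.
  exact/continuous_subspaceT/line_continuous.
- by exists 1; rewrite ?scale1r 1?addrC ?subrK//= in_itv /= lexx ler01.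
Qed.

(** The component of [x] contains the whole ray, which is unbounded. *)
Lemma ray_not_enclosed x d : d <> 0 ->
  (forall t, 0 <= t -> ~ pline (x + t *: d)) -> ~ encl x.
Proof.
move=> d0 xd [nx] /ex_strict_bound_gt0[M M0 hM].
have inC t : 0 <= t -> connected_component (~` pline) x (x + t *: d).
  move=> t0.
  apply: (@connected_component_max _ _ [set x + t *: d | t in `[0, +oo[%classic]).
  - by exists 0; rewrite ?scale0r ?addr0//= in_itv /= lexx.
  - by move=> _ [s + <-]; rewrite /= in_itv /= andbT => /xd.
  - apply: connected_continuous_connected; last exact/continuous_subspaceT/line_continuous.
    by apply/connected_intervalP; exact: interval_is_interval.
  - by exists t => //=; rewrite in_itv /= t0.
have bnd t : 0 <= t -> `|x.1 + t * d.1| < M /\ `|x.2 + t * d.2| < M.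
  by move=> /inC /hM /=; rewrite prod_normE gt_max => /andP[].
have unb (a c : R) : c != 0 -> exists2 t, 0 <= t & M <= `|a + t * c|.
  move=> c0; exists ((M + `|a|) / `|c|).
    by rewrite divr_ge0// addr_ge0// ltW.
  have cc : 0 < `|c| by rewrite normr_gt0.
  rewrite [X in `|X|]addrC; apply: le_trans (lerB_normD _ _).
  rewrite lerBrDr normrM normf_div.
  by rewrite normr_id divfK ?gt_eqF// ?ler_norm.
have : (d.1 != 0) || (d.2 != 0).
  rewrite -negb_and; apply/negP => /andP[/eqP d1 /eqP d2].
  by apply: d0; exact: injective_projections.
case/orP => [/(unb x.1)[s s0]|/(unb x.2)[s s0]]; have [h1 h2] := bnd s s0;
  by rewrite leNgt ?h1 ?h2.
Qed.

(** Near an interior point of a side the only obstacle is the line of the side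
    itself. *)
Lemma half_disc j u : 0 < u < len j -> exists2 r, 0 < r &
  forall h, small r h -> cross (T j) h <> 0 -> ~ pline (pt j u + h).
Proof.
move=> uj; have [|r r0 hr] := @avoid_sides (predC1 j) (pt j u).
  by move=> i t /eqP ij ti /(open_pt_inj uj ti)[/esym].
exists r => // h hs ch /polylineP[i [t [ti e]]].
have [ij|ij] := eqVneq i j; last exact: (hr h hs i t ij ti).
subst i; apply: ch.
have -> : h = (t - u) *: T j.
  by apply: (addrI (pt j u)); rewrite e -ptD; congr pt; ring.
by rewrite crossZ crossxx mulr0.
Qed.

(** The two half-discs cut out by the side are convex, so that being enclosed is
    constant on each of them. *)
Lemma half_disc_enclosed j u : 0 < u < len j -> exists2 r, 0 < r &
  forall h h', small r h -> small r h' -> 0 < cross (T j) h * cross (T j) h' ->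
    encl (pt j u + h) -> encl (pt j u + h').
Proof.
move=> uj; have [r r0 hr] := half_disc uj; exists r => // h h' hh hh' c.
apply: enclosed_segment => t t01; rewrite segment_offset; apply: hr.
  exact: small_convex.
have -> : cross (T j) (h + t *: (h' - h)) = (1 - t) * cross (T j) h + t * cross (T j) h'.
  by rewrite /cross /= /GRing.scale /=; ring.
case/andP: t01 => t0 t1; move: c.
set A := cross _ h; set B := cross _ h' => AB e.
have A2 : 0 < A * A.
  by rewrite -expr2 exprn_even_gt0 //=; apply: contraTneq AB => ->; rewrite mul0r ltxx.
have e2 : (1 - t) * (A * A) + t * (A * B) = 0.
  by rewrite -[RHS](mul0r A) -e; ring.
have := mulr_ge0 t0 (ltW AB); have : 0 <= (1 - t) * (A * A) by rewrite mulr_ge0 ?subr_ge0// ltW.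
have [t2|t2] := leP t (1 / 2); nra.
Qed.

(** The orientation of the polygon, rescaled to unit normals. *)
Lemma left_enclosed j u : 0 < u < len j ->
  exists2 e, 0 < e & forall t, 0 < t < e -> enclosed vtx (pt j u + t *: rot90 (T j)).
Proof.
move=> /andP[u0 uL]; have L0 := side_length_gt0 j.
have [|e e0 he] := @positive R Q j (u / len j).
  by rewrite ltr_pdivrMr// mul1r uL divr_gt0.
exists (e * len j); first exact: mulr_gt0.
move=> t /andP[t0 te]; have := he (t / len j).
rewrite side_pointE divfK ?gt_eqF// side_vecE.
have -> : rot90 (len j *: T j) = len j *: rot90 (T j).
  by apply: injective_projections => /=; rewrite /GRing.scale /= ?mulrN.
by rewrite scalerA divfK ?gt_eqF//; apply; rewrite divr_gt0//= ltr_pdivrMr.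
Qed.

Lemma left_small_enclosed j u : 0 < u < len j -> exists2 r, 0 < r &
  forall h, small r h -> 0 < cross (T j) h -> encl (pt j u + h).
Proof.
move=> uj; have [r r0 hr] := half_disc_enclosed uj.
exists r => // h hh hc; have [e e0 he] := left_enclosed uj.
have [e' e'0 he'] := small_shrink (rot90 (T j)) r0.
set t := Num.min e e' / 2.
have t0 : 0 < t by rewrite divr_gt0// lt_min e0.
have [te te'] : t < e /\ t < e'.
  have : t < Num.min e e' by rewrite ltr_pdivrMr// mulr2n mulrDr mulr1 ltrDl lt_min e0.
  by rewrite lt_min => /andP[].
apply: (hr (t *: rot90 (T j))) => //; last by apply: he; rewrite t0.
  by apply: he'; rewrite ltW.
by rewrite crossZ cross_rot90 mulr1 mulr_gt0.
Qed.

Lemma leave_left j u d : 0 < u < len j -> 0 < cross (T j) d ->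
  exists2 e, 0 < e & forall t, 0 < t < e -> encl (pt j u + t *: d).
Proof.
move=> uj dj; have [r r0 hr] := left_small_enclosed uj.
have [e e0 he] := small_shrink d r0; exists e => // t /andP[t0 te].
by apply: hr; [apply: he; rewrite ltW|rewrite crossZ mulr_gt0].
Qed.

Definition right_enclosed j u := exists2 r, 0 < r &
  forall h, small r h -> cross (T j) h < 0 -> encl (pt j u + h).

Lemma exists_right (r : R) j : 0 < r -> exists2 h, small r h & cross (T j) h < 0.
Proof.
move=> r0; have [e e0 he] := small_shrink (- rot90 (T j)) r0.
exists ((e / 2) *: - rot90 (T j)); first by apply: he; lra.
rewrite crossZ; have -> : cross (T j) (- rot90 (T j)) = - 1.
  by rewrite -(cross_rot90 j) /cross /=; ring.
by rewrite mulrN1 oppr_lt0 divr_gt0.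
Qed.

Lemma right_enclosedI j u : 0 < u < len j -> exists2 r, 0 < r &
  forall h, small r h -> cross (T j) h < 0 -> encl (pt j u + h) ->
    right_enclosed j u.
Proof.
move=> uj; have [r r0 hr] := half_disc_enclosed uj.
exists r => // h hh hc he; exists r => // h' hh' hc'.
by apply: hr he => //; rewrite nmulr_rgt0.
Qed.

(** A half-disc at [u] contains the small half-discs at all nearby points of the
    side, so [right_enclosed] is locally constant along a side. *)
Lemma right_enclosed_near j u : 0 < u < len j -> exists2 r, 0 < r &
  forall w, `|w - u| < r / 2 ->
    (right_enclosed j w <->
      forall h, small r h -> cross (T j) h < 0 -> encl (pt j u + h)).
Proof.
move=> uj; have [r r0 hr] := half_disc_enclosed uj.
exists r => // w wu.
have ptw h : pt j w + h = pt j u + ((w - u) *: T j + h).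
  by rewrite addrA -ptD; congr (pt _ _ + _); ring.
have cw h : cross (T j) ((w - u) *: T j + h) = cross (T j) h.
  by rewrite crossD crossZ crossxx mulr0 add0r.
have sw h : small (r / 2) h -> small r ((w - u) *: T j + h).
  by move=> hh; apply: smallD => //; exact: small_tangent.
split=> [[e e0 he] h hh hc|H].
  have [|h0] := @exists_right (Num.min e (r / 2)) j; first by rewrite lt_min e0 divr_gt0.
  move=> hs c0.
  have : encl (pt j w + h0).
    by apply: he => //; apply: small_le hs; rewrite ge_min lexx.
  rewrite ptw; apply: hr => //; last by rewrite cw nmulr_rgt0.
  by apply/sw; apply: small_le hs; rewrite ge_min lexx orbT.
exists (r / 2) => [|h hh hc]; first by rewrite divr_gt0.
by rewrite ptw; apply: H; [exact: sw|rewrite cw].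
Qed.

Lemma right_enclosed_slide j u w : 0 < u < len j -> 0 < w < len j ->
  right_enclosed j u -> right_enclosed j w.
Proof.
apply: locally_constant_itv => {}u uj.
have [r r0 hr] := right_enclosed_near uj.
have r2 : 0 < r / 2 by rewrite divr_gt0.
exists (r / 2) => // {}w wj wu.
by rewrite (hr u) ?subrr ?normr0// (hr w)// distrC.
Qed.

(** Close to a vertex the boundary consists of the two adjacent sides only. *)
Lemma vertex_disc j : exists2 r, 0 < r & forall h, small r h ->
  pline (vtx (ordS j) + h) ->
  exists2 w, 0 <= w & h = - w *: T j \/ h = w *: T (ordS j).
Proof.
have [|r r0 hr] := @avoid_sides [pred i | (i != j) && (i != ordS j)] (vtx (ordS j)).
  move=> i t /andP[/eqP ij /eqP ik] ti /(vtx_on_side ti)[[//]|[/ordS_inj]//].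
exists r => // h hh /polylineP[i [t [ti e]]].
have [ij|ij] := eqVneq i j.
  subst i; exists (len j - t); first by case/andP: ti => ? ?; lra.
  left; move: e; rewrite pt_end_shift -scaleNr => /addrI ->//.
have [ik|ik] := eqVneq i (ordS j).
  subst i; exists t; first by case/andP: ti.
  by right; move: e; rewrite /pt => /addrI.
by case: (hr h hh i t _ ti e); rewrite /= ij ik.
Qed.

(** Around a vertex the right-hand sides of the two adjacent edges are joined
    inside a small disc. When the boundary turns left or goes straight on, the
    two right half-discs avoid the boundary and overlap; when it turns right,
    their intersection is a convex sector that avoids the boundary. *)
Lemma right_enclosed_turn j u w : 0 < u < len j -> 0 < w < len (ordS j) ->
  right_enclosed j u -> right_enclosed (ordS j) w.
Proof.
move=> uj; set k := ordS j => wk REj.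
set a := T j; set b := T k; pose kap := cross a b.
have [rho rho0 hrho] := vertex_disc j.
have Lj := side_length_gt0 j; have Lk := side_length_gt0 k.
(* The two sides are compared at distance [r] from the vertex. *)
have [|r r0 /= /and4P[r1 r2 r3 _]] := @pos_lower_bound R [:: len j; len k; rho / 2].
  by rewrite /= Lj Lk divr_gt0.
have u1j : 0 < len j - r < len j by lra.
have [e1 e10 he1] := right_enclosed_slide uj u1j REj.
have rk : 0 < r < len k by lra.
have [e2 e20 he2] := right_enclosedI rk.
(* In a right turn [eta] must be small against the sine of the turn, so that each
   of [x1], [x2] lies on the right of both sides. *)
have [|eta eta0 /= /and5P[eta1 eta2 eta3 eta4 _]] :=
  @pos_lower_bound R [:: e1; e2; rho / 2; (if kap < 0 then - (r * kap) else 1)].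
  by rewrite /= e10 e20 divr_gt0//= andbT; case: ifP => // kap0; rewrite -mulrN mulr_gt0// oppr_gt0.
pose x1 := - r *: a + - eta *: rot90 a.
pose x2 := r *: b + - eta *: rot90 b.
have netan : `|- eta| = eta by rewrite normrN gtr0_norm.
have nrn : `|- r| = r by rewrite normrN gtr0_norm.
have sx1 : small rho x1 by apply: smallD; [apply: small_tangent|apply: small_normal]; rewrite ?nrn ?netan.
have sx2 : small rho x2.
  by apply: smallD; [apply: small_tangent|apply: small_normal]; rewrite ?netan ?gtr0_norm.
have Ex1 : encl (vtx k + x1).
  have -> : vtx k + x1 = pt j (len j - r) + - eta *: rot90 a.
    by rewrite pt_end_shift subKr -scaleNr -addrA.
  apply: he1; first by apply: small_normal; rewrite netan.
  by rewrite crossZ cross_rot90 mulr1 oppr_lt0.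
suff Ex2 : encl (vtx k + x2).
  apply: (right_enclosed_slide rk wk).
  apply: (he2 (- eta *: rot90 b)); first by apply: small_normal; rewrite netan.
    by rewrite crossZ cross_rot90 mulr1 oppr_lt0.
  by rewrite /pt -addrA.
have caa := crossxx a; have cbb := crossxx b.
have cba : cross b a = - kap by rewrite /kap /cross; ring.
have crot x y : cross x (rot90 y) = dot x y by rewrite /cross /dot /rot90 /=; ring.
have dotC x y : dot x y = dot y x by rewrite /dot; ring.
have cx1 (c : R * R) : cross c x1 = - r * cross c a + - eta * dot c a.
  by rewrite crossD -crot; congr (_ + _); exact: crossZ.
have cx2 (c : R * R) : cross c x2 = r * cross c b + - eta * dot c b.
  by rewrite crossD -crot; congr (_ + _); exact: crossZ.
have daa : dot a a = 1 by rewrite -crot cross_rot90.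
have dbb : dot b b = 1 by rewrite -crot cross_rot90.
have cx1a : cross a x1 < 0 by rewrite cx1 caa daa; lra.
have cx2b : cross b x2 < 0 by rewrite cx2 cbb dbb; lra.
have ub := tangent_unit k; have ua := tangent_unit j.
have sq2 : a.1 ^+ 2 + a.2 ^+ 2 + (b.1 ^+ 2 + b.2 ^+ 2) = 2 by rewrite ua ub.
have dsum : (a.1 + b.1) ^+ 2 + (a.2 + b.2) ^+ 2 = 2 + 2 * dot a b.
  by rewrite -[X in _ = X + _]sq2 /dot; ring.
have ddif : (a.1 - b.1) ^+ 2 + (a.2 - b.2) ^+ 2 = 2 - 2 * dot a b.
  by rewrite -[X in _ = X - _]sq2 /dot; ring.
have dot1 : -1 <= dot a b <= 1.
  have := sqr_ge0 (a.1 + b.1); have := sqr_ge0 (a.2 + b.2).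
  by have := sqr_ge0 (a.1 - b.1); have := sqr_ge0 (a.2 - b.2); lra.
have [kap0|kap0] := ltP kap 0.
  rewrite kap0 in eta4.
  apply: enclosed_segment Ex1 => t t01; rewrite segment_offset => /hrho [].
    exact: small_convex.
  move=> s s0 [] hs.
    have : cross a (x1 + t *: (x2 - x1)) < 0.
      apply: cross_convex => //; rewrite cx2 -/kap.
      by nra.
    by rewrite hs crossZ caa mulr0 ltxx.
  have : cross b (x1 + t *: (x2 - x1)) < 0.
    apply: cross_convex => //; rewrite cx1 cba dotC.
    by nra.
  by rewrite hs crossZ cbb mulr0 ltxx.
have segA h h' : small rho h -> small rho h' -> cross a h < 0 -> cross a h' < 0 ->
    encl (vtx k + h) -> encl (vtx k + h').
  move=> hh hh' ch ch'; apply: enclosed_segment => t t01; rewrite segment_offset => /hrho [].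
    exact: small_convex.
  have := cross_convex t01 ch ch'; move: (h + _) => z cz s s0 [] zE; move: cz.
    by rewrite zE crossZ caa mulr0 ltxx.
  by rewrite zE crossZ -/kap ltNge mulr_ge0.
have segB h h' : small rho h -> small rho h' -> cross b h < 0 -> cross b h' < 0 ->
    encl (vtx k + h) -> encl (vtx k + h').
  move=> hh hh' ch ch'; apply: enclosed_segment => t t01; rewrite segment_offset => /hrho [].
    exact: small_convex.
  have := cross_convex t01 ch ch'; move: (h + _) => z cz s s0 [] zE; move: cz.
    by rewrite zE crossZ cba mulrNN ltNge mulr_ge0.
  by rewrite zE crossZ cbb mulr0 ltxx.
(* The bisector of the two right normals points into both half-discs. *)
have [e e0 he] := small_shrink (- (rot90 a + rot90 b)) rho0.
pose y := (e / 2) *: - (rot90 a + rot90 b).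
have sy : small rho y by apply: he; lra.
have dot1' : -1 < dot a b.
  rewrite lt_neqAle; case/andP: dot1 => -> _; rewrite andbT; apply/eqP => d1.
  move: dsum; rewrite -d1 mulrN1 subrr => /eqP; rewrite paddr_eq0 ?sqr_ge0// !sqrf_eq0.
  move=> /andP[/eqP s1 /eqP s2]; apply: (@not_antiparallel j).
  have e1' : b.1 = - a.1 by lra.
  have e2' : b.2 = - a.2 by lra.
  exact: injective_projections.
have cN x z : cross x (- z) = - cross x z by rewrite /cross /=; ring.
have edot : 0 < e * (1 + dot a b) by rewrite mulr_gt0//; lra.
have ya : cross a y < 0 by rewrite crossZ cN crossD !crot daa; nra.
have yb : cross b y < 0.
  by rewrite crossZ cN crossD !crot (dotC b a) dbb; nra.
by apply: (segB y) => //; apply: (segA x1).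
Qed.

(** Alternate slides along the sides and turns at the vertices until the curve
    has been followed all the way round to side [k]. *)
Lemma right_enclosed_all j u k w : 0 < u < len j -> 0 < w < len k ->
  right_enclosed j u -> right_enclosed k w.
Proof.
move=> uj wk REj.
have mid i : 0 < len i / 2 < len i by have := side_length_gt0 i; lra.
apply: (right_enclosed_slide (mid k) wk).
have it m : right_enclosed (iter m (@ordS _) j) (len (iter m (@ordS _) j) / 2).
  elim: m => [|m IH] /=; first exact: (right_enclosed_slide uj).
  exact: (right_enclosed_turn (mid _) (mid _) IH).
have n0 : (0 < nsides Q)%N by apply: leq_trans (nsides_ge3 Q).
have -> : k = iter (k + (nsides Q - j)) (@ordS _) j.
  have vi m : iter m (@ordS _) j = ((j + m) %% nsides Q)%N :> nat.
    elim: m => [|m IH] /=; first by rewrite addn0 modn_small.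
    by rewrite IH -addn1 modnDml addn1 addnS.
  apply/val_inj => /=; rewrite vi addnCA subnKC 1?ltnW//.
  by rewrite modnDr modn_small.
exact: it.
Qed.

(** * Lines and the order of their crossings *)

Definition generic_line d c := forall i, H d c (vtx i) <> 0.

Definition crosses d c i : bool := H d c (vtx i) * H d c (vtx (ordS i)) < 0.

(** The crossing point is the barycentre of the two ends of the side weighted by
    their heights. Numerator and denominator of its coordinate along [d] are kept
    apart because each is a polynomial in the line, hence continuous. *)
Definition crossing_num d c i : R :=
  H d c (vtx i) * dot (vtx (ordS i)) d - H d c (vtx (ordS i)) * dot (vtx i) d.

Definition crossing_den d c i : R := H d c (vtx i) - H d c (vtx (ordS i)).

Definition position d c i : R := crossing_num d c i / crossing_den d c i.

Lemma height_next d c i : H d c (vtx (ordS i)) = H d c (vtx i) + len i * cross (T i) d.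
Proof. by rewrite vtx_next heightD. Qed.

Lemma crosses_den_neq0 d c i : crosses d c i -> crossing_den d c i != 0.
Proof.
rewrite /crosses /crossing_den; apply: contraTneq => /subr0_eq ->.
by rewrite -leNgt -expr2 sqr_ge0.
Qed.

Lemma crosses_pt d c i : crosses d c i -> exists2 u, 0 < u < len i &
  H d c (pt i u) = 0 /\ dot (pt i u) d = position d c i.
Proof.
move=> ci; have L0 := side_length_gt0 i; have D0 := crosses_den_neq0 ci.
move: (ci) (D0); rewrite /crosses /position /crossing_num /crossing_den height_next vtx_next.
set a := H d c (vtx i); set l := len i in L0 * => hc hD.
have m0 : cross (T i) d != 0.
  by apply: contraNneq hD => ->; rewrite mulr0 addr0 subrr.
set m := cross (T i) d in hc hD m0 *.
exists (- a / m).
  have hm : (- a / m) * m = - a by rewrite divfK.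
  set u := - a / m in hm *.
  have : 0 < u * (l - u) * (m * m) by nra.
  have m2 : 0 < m * m by rewrite -expr2 exprn_even_gt0.
  rewrite pmulr_lgt0// => uu; apply/andP; split.
    case: (ltP 0 u) => // u0; have h : 0 <= l - u by lra.
    by have := mulr_le0_ge0 u0 h; rewrite leNgt uu.
  case: (ltP u l) => // u0; have h : l - u <= 0 by lra.
  have h' : 0 <= u by lra.
  by have := mulr_ge0_le0 h' h; rewrite leNgt uu.
split; first by rewrite /pt heightD -/a -/m divfK// subrr.
have e : a - (a + l * m) = - (l * m) by ring.
rewrite /pt /dot /= /GRing.scale /= e; field.
by rewrite m0 gt_eqF.
Qed.

Lemma pt_crosses d c i u : generic_line d c -> 0 <= u <= len i ->
  H d c (pt i u) = 0 -> 0 < u < len i /\ crosses d c i.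
Proof.
move=> gl /andP[u0 uL] Hu.
have u0' : u != 0 by apply/eqP => e; apply: (gl i); rewrite -Hu e pt0.
have uL' : u != len i by apply/eqP => e; apply: (gl (ordS i)); rewrite -Hu e pt_end.
have ui : 0 < u < len i by rewrite lt0r u0' u0 lt_neqAle uL'.
split=> //; rewrite /crosses height_next; move: Hu (gl i); rewrite /pt heightD.
set a := H _ _ _; set m := cross _ _; case/andP: ui => u1 u2 e a0.
have -> : a = - (u * m) by lra.
have m2 : 0 < m * m.
  rewrite -expr2 exprn_even_gt0//=; apply/eqP => m0; apply: a0.
  by rewrite m0 mulr0 addr0 in e.
have -> : - (u * m) * (- (u * m) + len i * m) = - ((u * (len i - u)) * (m * m)) by ring.
by rewrite oppr_lt0 mulr_gt0// mulr_gt0// subr_gt0.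
Qed.

(** Different sides are disjoint, so a line cannot cross two of them at the same
    point. *)
Lemma position_inj d c i j : dot d d = 1 -> crosses d c i -> crosses d c j ->
  position d c i = position d c j -> i = j.
Proof.
move=> d1 /crosses_pt[u ui [Hu pu]] /crosses_pt[w wj [Hw pw]] e.
have := on_line d1 Hu Hw; rewrite pu pw e subrr scale0r addr0 => /esym E.
have wj' : 0 <= w <= len j by lra.
by have [] := open_pt_inj ui wj' E.
Qed.

(** The difference of two positions with its denominators cleared; up to the sign
    of the denominators it tells which crossing comes first. *)
Definition before d c i j : R :=
  crossing_num d c i * crossing_den d c j - crossing_num d c j * crossing_den d c i.

Lemma position_lt d c i j : crosses d c i -> crosses d c j ->
  (position d c i < position d c j) =
  (before d c i j * (crossing_den d c i * crossing_den d c j) < 0).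
Proof.
move=> /crosses_den_neq0 Di /crosses_den_neq0 Dj; rewrite /position /before.
set ni := crossing_num _ _ i; set nj := crossing_num _ _ j.
rewrite -subr_lt0.
have -> : (ni * crossing_den d c j - nj * crossing_den d c i) *
   (crossing_den d c i * crossing_den d c j) =
   (ni / crossing_den d c i - nj / crossing_den d c j) *
   (crossing_den d c i * crossing_den d c j) ^+ 2.
  by field; rewrite Dj Di.
by rewrite pmulr_llt0// exprn_even_gt0//= mulf_neq0.
Qed.

Definition next_crossing d c j k :=
  [/\ crosses d c j, crosses d c k, position d c j < position d c k &
     forall i, crosses d c i -> ~ (position d c j < position d c i < position d c k)].

Section Path.

Variables (d : R -> R * R) (c : R -> R).
Hypotheses (cd1 : continuous (fun t : R => (d t).1 : R))
  (cd2 : continuous (fun t : R => (d t).2 : R)) (cc : continuous c).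
Hypotheses (d1 : forall t, dot (d t) (d t) = 1).
Hypothesis gl : forall t, 0 <= t <= 1 -> generic_line (d t) (c t).

Let cH x : continuous (fun t : R => H (d t) (c t) x : R).
Proof.
by move=> t; exact: (cvgB (cvgB (cvgM (cvg_cst x.1) (@cd2 t)) (cvgM (cvg_cst x.2) (@cd1 t))) (@cc t)).
Qed.

Let cdot x : continuous (fun t : R => dot x (d t) : R).
Proof.
by move=> t; exact: (cvgD (cvgM (cvg_cst x.1) (@cd1 t)) (cvgM (cvg_cst x.2) (@cd2 t))).
Qed.

Let cnum i : continuous (fun t : R => crossing_num (d t) (c t) i : R).
Proof.
by move=> t; exact: (cvgB (cvgM (@cH _ t) (@cdot _ t)) (cvgM (@cH _ t) (@cdot _ t))).
Qed.

Let cden i : continuous (fun t : R => crossing_den (d t) (c t) i : R).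
Proof. by move=> t; exact: (cvgB (@cH _ t) (@cH _ t)). Qed.

Let cbefore i j : continuous (fun t : R => before (d t) (c t) i j : R).
Proof.
by move=> t; exact: (cvgB (cvgM (@cnum i t) (@cden j t)) (cvgM (@cnum j t) (@cden i t))).
Qed.

Let sH i : 0 < H (d 0) (c 0) (vtx i) * H (d 1) (c 1) (vtx i).
Proof.
by apply: (nonvanishing_same_sign (@cH (vtx i))) => t t01; exact: gl.
Qed.

Let sHt i t : 0 <= t <= 1 -> 0 < H (d 0) (c 0) (vtx i) * H (d t) (c t) (vtx i).
Proof.
move=> /andP[t0 t1].
have := @nonvanishing_same_sign R (fun s => H (d (s * t)) (c (s * t)) (vtx i)).
rewrite mul0r mul1r; apply.
  move=> s; apply: (@continuous_comp _ _ _ (fun s : R => s * t) (fun t : R => H (d t) (c t) (vtx i))); last exact: cH.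
  by apply: cvgM; [exact: cvg_id|exact: cvg_cst].
by move=> s /andP[s0 s1]; apply: gl; nra.
Qed.

Let crosses_t i t : 0 <= t <= 1 -> crosses (d t) (c t) i = crosses (d 0) (c 0) i.
Proof.
move=> t01; have := sHt i t01; have := sHt (ordS i) t01; rewrite /crosses.
by move=> h1 h2; apply/idP/idP; nra.
Qed.

Let sden i : crosses (d 0) (c 0) i ->
  0 < crossing_den (d 0) (c 0) i * crossing_den (d 1) (c 1) i.
Proof.
have := sH i; have := sH (ordS i); rewrite /crosses /crossing_den.
set a := H _ _ _; set b := H _ _ _; set a' := H _ _ _; set b' := H _ _ _.
move=> h1 h2 h3.
have : 0 < - (a' * b) by nra.
have : 0 < - (a * b') by nra.
by nra.
Qed.

(** While no vertex meets the moving line, the set of crossed sides stays the same,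
    and two crossings cannot swap because they would have to coincide at some
    time ([position_inj]). *)
Lemma next_crossing_path j k : next_crossing (d 0) (c 0) j k ->
  next_crossing (d 1) (c 1) j k.
Proof.
have o1 : 0 <= (1 : R) <= 1 by rewrite ler01 lexx.
have o0 : 0 <= (0 : R) <= 1 by rewrite ler01 lexx.
have lt01 i i' : crosses (d 0) (c 0) i -> crosses (d 0) (c 0) i' ->
    (position (d 0) (c 0) i < position (d 0) (c 0) i') =
    (position (d 1) (c 1) i < position (d 1) (c 1) i').
  move=> ci ci'.
  have [ii|ii] := eqVneq i i'; first by rewrite ii !ltxx.
  rewrite !position_lt ?(crosses_t _ o1)//.
  have sb : 0 < before (d 0) (c 0) i i' * before (d 1) (c 1) i i'.
    apply: (nonvanishing_same_sign (@cbefore i i')) => t t01 b0.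
    have cit : crosses (d t) (c t) i by rewrite crosses_t.
    have cit' : crosses (d t) (c t) i' by rewrite crosses_t.
    move/eqP: ii; apply; apply: (@position_inj (d t) (c t)) => //.
    apply/eqP; rewrite /position eqr_div ?crosses_den_neq0//.
    by rewrite -subr_eq0; apply/eqP.
  have := mulr_gt0 (sden ci) (sden ci').
  set x := before _ _ _ _ in sb *; set x' := before _ _ _ _ in sb *.
  set a := crossing_den _ _ _; set a' := crossing_den _ _ _.
  set e := crossing_den _ _ _; set e' := crossing_den _ _ _ => h.
  have hh : 0 < (x * (a * e)) * (x' * (a' * e')) by nra.
  by apply/idP/idP; nra.
move=> [cj ck jk H]; split; rewrite ?(crosses_t _ o1)// -?lt01//.
by move=> i; rewrite (crosses_t _ o1) => ci; rewrite -!lt01//; exact: H.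
Qed.

End Path.

(** * Flights *)

Lemma enclosed_along x d t : (forall t', 0 < t' < t -> ~ pline (x + t' *: d)) ->
  (forall e : R, 0 < e -> exists2 s, 0 < s < e & encl (x + s *: d)) ->
  forall t', 0 < t' < t -> encl (x + t' *: d).
Proof.
move=> av near t' /andP[t'0 t't].
have [s /andP[s0 st] es] := near t' t'0.
apply: enclosed_segment es => w /andP[w0 w1].
have -> : x + s *: d + w *: (x + t' *: d - (x + s *: d)) = x + (s + w * (t' - s)) *: d.
  by apply: injective_projections => /=; rewrite /GRing.scale /=; ring.
by apply: av; apply/andP; split; nra.
Qed.

(** Boundary points on the ray are crossings of the line, and their position tells
    the time at which the ray arrives. *)
Lemma ray_hits d c j u t x : dot d d = 1 -> generic_line d c -> 0 < u < len j ->
  H d c (pt j u) = 0 -> 0 < t -> x = pt j u + t *: d -> pline x ->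
  exists2 i, crosses d c i & position d c i = dot (pt j u) d + t.
Proof.
move=> d1 gl uj Hu t0 xE /polylineP[i [w [wi e]]].
have Hx : H d c (pt i w) = 0.
  by rewrite -e xE heightD Hu crossxx mulr0 addr0.
have [wi' ci] := pt_crosses gl wi Hx; exists i => //.
have [w' w'i [Hw' <-]] := crosses_pt ci.
have E := on_line d1 Hx Hw'.
have wE : w' = w.
  move: Hx Hw'; rewrite /pt !heightD => h1 h2.
  have : (w' - w) * cross (T i) d = 0 by lra.
  move/eqP; rewrite mulf_eq0 => /orP[/eqP|/eqP m0]; first lra.
  by have := gl i; rewrite -h1 m0 !mulr0 addr0.
have -> : dot (pt i w') d = dot x d by rewrite wE -e.
by rewrite xE -[t in RHS]mulr1 -d1 /dot /= /GRing.scale /=; ring.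
Qed.

Lemma pt_position d c j u : generic_line d c -> 0 < u < len j ->
  H d c (pt j u) = 0 -> crosses d c j /\ dot (pt j u) d = position d c j.
Proof.
move=> gl uj Hu.
have uj' : 0 <= u <= len j by lra.
have [_ cj] := pt_crosses gl uj' Hu; split=> //.
have [w wj [Hw <-]] := crosses_pt cj.
suff -> : u = w by [].
move: Hu Hw; rewrite /pt !heightD => h1 h2.
have : (u - w) * cross (T j) d = 0 by lra.
move/eqP; rewrite mulf_eq0 => /orP[/eqP|/eqP m0]; first lra.
by have := gl j; rewrite -h1 m0 !mulr0 addr0.
Qed.

(** The ray enters the enclosed region, so it cannot avoid the boundary for ever;
    take the crossing with the least position. *)
Lemma next_crossing_exists d c j u : dot d d = 1 -> generic_line d c ->
  0 < u < len j -> H d c (pt j u) = 0 -> 0 < cross (T j) d ->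
  exists k, next_crossing d c j k.
Proof.
move=> d1 gl uj Hu dj; have [cj pj] := pt_position gl uj Hu.
have [i0 ci0] : exists i, crosses d c i && (position d c j < position d c i).
  apply: contrapT => no.
  have [e e0 he] := leave_left uj dj.
  have e20 : 0 < e / 2 by rewrite divr_gt0.
  have : encl (pt j u + (e / 2) *: d) by apply: he; lra.
  apply: (ray_not_enclosed (unit_neq0 d1)) => t t0 /(ray_hits d1 gl uj Hu).
  have tt : 0 < e / 2 + t by lra.
  rewrite -addrA -scalerDl => /(_ _ tt erefl)[i ci pi]; apply: no; exists i.
  by rewrite ci pi pj ltrDl.
case: (@arg_minP _ _ _ i0 (fun i => crosses d c i && (position d c j < position d c i)) (position d c) ci0) => k /andP[ck jk] mk.
exists k; split=> // i ci /andP[ji ik].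
by have := mk i; rewrite ci ji leNgt ik => /(_ isT).
Qed.

Lemma next_crossing_flight d c j k u : dot d d = 1 -> generic_line d c ->
  0 < u < len j -> H d c (pt j u) = 0 -> next_crossing d c j k ->
  exists2 t, 0 < t & exists2 w, 0 < w < len k & pt k w = pt j u + t *: d /\
    forall t', 0 < t' < t -> ~ pline (pt j u + t' *: d).
Proof.
move=> d1 gl uj Hu [cj ck jk nb]; have [_ pj] := pt_position gl uj Hu.
have [w wk [Hw pw]] := crosses_pt ck.
exists (position d c k - position d c j); first by rewrite subr_gt0.
exists w => //; split; first by rewrite -pw -pj; exact: (on_line d1 Hu Hw).
move=> t' /andP[t'0 t't] /(ray_hits d1 gl uj Hu t'0 erefl)[i ci pi].
by apply: (nb i ci); rewrite pi pj; lra.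
Qed.

(** A flight inside the polygon ends on the left of the side that it meets. If
    it ended on the right of one side, the right of every side would be enclosed,
    whereas beyond its last crossing the line runs off to infinity. *)
Lemma arrives_from_left d c j k u : dot d d = 1 -> generic_line d c ->
  0 < u < len j -> H d c (pt j u) = 0 -> 0 < cross (T j) d ->
  next_crossing d c j k -> cross (T k) d < 0.
Proof.
move=> d1 gl uj Hu dj nx; rewrite ltNge; apply/negP => dk0.
have [t t0 [w wk [wE av]]] := next_crossing_flight d1 gl uj Hu nx.
case: nx => cj ck _ _.
have dk : 0 < cross (T k) d.
  rewrite lt_neqAle dk0 andbT eq_sym; apply/eqP => m0.
  have := ck; rewrite /crosses height_next m0 mulr0 addr0.
  by rewrite ltNge -expr2 sqr_ge0.
have ins : forall t', 0 < t' < t -> encl (pt j u + t' *: d).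
  apply: (enclosed_along av) => e e0; have [e' e'0 he] := leave_left uj dj.
  exists (Num.min e e' / 2); have m0 : 0 < Num.min e e' by rewrite lt_min e0.
    have : Num.min e e' <= e by rewrite ge_min lexx.
    by lra.
  apply: he; have : Num.min e e' <= e' by rewrite ge_min lexx orbT.
  by lra.
have RE : right_enclosed k w.
  have [r r0 hr] := right_enclosedI wk.
  have [e e0 he] := small_shrink (- d) r0.
  pose s := Num.min e t / 2.
  have m0 : 0 < Num.min e t by rewrite lt_min e0.
  have [s0 [se st]] : 0 < s /\ s < e /\ s < t.
    have : Num.min e t <= e by rewrite ge_min lexx.
    have : Num.min e t <= t by rewrite ge_min lexx orbT.
    by rewrite /s; lra.
  apply: (hr (s *: - d)).
  - by apply: he; rewrite ltW.
  - rewrite crossZ; have -> : cross (T k) (- d) = - cross (T k) d by rewrite /cross /=; ring.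
    by rewrite mulrN oppr_lt0 mulr_gt0.
  - rewrite wE -addrA scalerN -scalerBl; apply: ins; lra.
(* The last crossing: beyond it the ray escapes, though both of its sides are
   enclosed. *)
case: (@arg_maxP _ _ _ j (crosses d c) (position d c) cj) => i ci mi.
have [v vi [Hv pv]] := crosses_pt ci.
have beyond s : 0 < s -> ~ encl (pt i v + s *: d).
  move=> s0; apply: (ray_not_enclosed (unit_neq0 d1)) => s' s'0.
  rewrite -addrA -scalerDl => /(ray_hits d1 gl vi Hv).
  have ss : 0 < s + s' by lra.
  move=> /(_ _ ss erefl)[i' ci' pi'].
  have le : position d c i' <= position d c i := mi i' ci'.
  by move: le; rewrite pi' pv leNgt ltrDl ss.
have [di|di] := ltP 0 (cross (T i) d).
  have [e e0 he] := leave_left vi di.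
  have e20 : 0 < e / 2 by rewrite divr_gt0.
  by apply: (beyond _ e20); apply: he; lra.
have di' : cross (T i) d < 0.
  rewrite lt_neqAle di andbT; apply/eqP => m0.
  have := ci; rewrite /crosses height_next m0 mulr0 addr0.
  by rewrite ltNge -expr2 sqr_ge0.
have [r r0 hr] := right_enclosed_all wk vi RE.
have [e e0 he] := small_shrink d r0.
have e20 : 0 < e / 2 by rewrite divr_gt0.
apply: (beyond _ e20); apply: hr; first by apply: he; lra.
by rewrite crossZ pmulr_rlt0.
Qed.

(** * The billiard map in the chart *)

(** The chart is (theta, s sin theta), in which the Liouville measure is the area.
    The arc length [s] is measured along the whole boundary, so that one plane
    holds the rays leaving all sides. *)
Definition of_chart y : R * R := (y.2 / sin y.1, y.1).

Definition to_chart x : R * R := (x.2, x.1 * sin x.2).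

Definition over j y :=
  0 < y.1 < pi /\ arc j * sin y.1 < y.2 < (arc j + len j) * sin y.1.

(** The ray in the chart at [y], leaving side [j], lies on the line with direction
    [dir j y.1] and this level. *)
Definition ray_level j y : R :=
  cross (vtx j) (dir j y.1) - arc j * sin y.1 + y.2.

(** The ray at [y] leaving [j] passes vertex [i] at signed distance
    [vertex_offset j i y.1 - y.2] ([vertex_heightE]). *)
Definition vertex_offset j i (a : R) : R :=
  cross (vtx i - vtx j) (dir j a) + arc j * sin a.

(** Requiring the whole line to miss the vertices, and not only the flight to side
    [k], makes this set open and stable with an explicit radius ([step_stable]). *)
Definition step j k y := [/\ over j y,
  generic_line (dir j y.1) (ray_level j y) &
  next_crossing (dir j y.1) (ray_level j y) j k].

Lemma vertex_heightE j y i :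
  H (dir j y.1) (ray_level j y) (vtx i) = vertex_offset j i y.1 - y.2.
Proof. by rewrite /H /ray_level /vertex_offset /cross /=; ring. Qed.

Lemma dirE j (a : R) : dir j a = cos a *: T j + sin a *: rot90 (T j).
Proof. by []. Qed.

Lemma dir_unit j (a : R) : dot (dir j a) (dir j a) = 1.
Proof.
transitivity ((cos a ^+ 2 + sin a ^+ 2) * ((T j).1 ^+ 2 + (T j).2 ^+ 2)).
  by rewrite dirE /dot /rot90 /= /GRing.scale /=; ring.
by rewrite cos2Dsin2 tangent_unit mulr1.
Qed.

Lemma cross_tangent_dir j (a : R) : cross (T j) (dir j a) = sin a.
Proof. by rewrite dirE crossD (crossZ _ (cos a)) (crossZ _ (sin a)) crossxx cross_rot90 mulr0 mulr1 add0r. Qed.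

Lemma over_foot j y : over j y ->
  [/\ 0 < sin y.1, 0 < y.2 / sin y.1 - arc j < len j &
   H (dir j y.1) (ray_level j y) (pt j (y.2 / sin y.1 - arc j)) = 0].
Proof.
move=> [th /andP[q1 q2]]; have s0 := sin_gt0_pi th; split=> //.
  by rewrite subr_gt0 ltr_pdivlMr// q1 ltrBlDl ltr_pdivrMr.
rewrite /pt heightD cross_tangent_dir mulrBl divfK ?gt_eqF//.
by rewrite /H /ray_level; ring.
Qed.

(** The foot lies inside side [j] exactly when the line separates the ends of the
    side; in this form the condition follows from the signs of two heights. *)
Lemma overP j y : over j y <-> [/\ 0 < y.1 < pi,
  vertex_offset j j y.1 - y.2 < 0 & 0 < vertex_offset j (ordS j) y.1 - y.2].
Proof.
rewrite /over /vertex_offset subrr side_vecE.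
have -> : cross (0 : R * R) (dir j y.1) = 0 by rewrite /cross /= !mul0r subrr.
have -> : cross (len j *: T j) (dir j y.1) = len j * sin y.1.
  by rewrite -(cross_tangent_dir j) /cross /= /GRing.scale /=; ring.
split=> [[-> /andP[h1 h2]]|[-> h1 h2]]; split=> //; lra.
Qed.

(** The turning angle from side [j] to side [k]. Choosing it in the interval from
    0 to 2 pi makes [turn j k - theta] the outgoing angle without any reduction
    modulo 2 pi ([flip_angle]). *)
Definition turn j k : R := polar (dot (T j) (T k)) (cross (T j) (T k)).

Lemma turnP j k : [/\ 0 <= turn j k < 2 * pi, cos (turn j k) = dot (T j) (T k) &
  sin (turn j k) = cross (T j) (T k)].
Proof.
apply: polarP.
transitivity (((T j).1 ^+ 2 + (T j).2 ^+ 2) * ((T k).1 ^+ 2 + (T k).2 ^+ 2)).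
  by rewrite /dot /cross; ring.
by rewrite !tangent_unit mulr1.
Qed.

(** Found by equating the distances from the origin to the line before and after
    the reflection, both expressed in the chart. *)
Definition shift j k (a : R) : R :=
  cross (vtx k - vtx j) (dir j a) + arc j * sin a + arc k * sin (turn j k - a).

(** The billiard map on [step j k], written in the chart. *)
Definition flip j k y : R * R := (turn j k - y.1, shift j k y.1 - y.2).

Lemma flip_angle j k (a : R) : 0 < a < pi -> cross (T k) (dir j a) < 0 ->
  [/\ 0 < turn j k - a < pi, sin (turn j k - a) = - cross (T k) (dir j a) &
      cos (turn j k - a) = dot (T k) (dir j a)].
Proof.
move=> api dk; have [tr ct st] := turnP j k; have p0 := pi_gt0 R.
have sE : sin (turn j k - a) = - cross (T k) (dir j a).
  by rewrite sinB ct st dirE /cross /dot /rot90 /= /GRing.scale /=; ring.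
split=> //.
  by apply: sin_gt0_range; [lra|rewrite sE; lra].
by rewrite cosB ct st dirE /cross /dot /rot90 /= /GRing.scale /=; ring.
Qed.

Lemma dir_reflect k (a : R) d : dot (T k) d = cos a -> - cross (T k) d = sin a ->
  dir k a = Defs.reflect k d.
Proof.
move=> h1 h2; rewrite dirE -h1 -h2 /Defs.reflect /normal.
have := tangent_unit k; case: (T k) => t1 t2 /= tu.
apply: injective_projections; rewrite /= /GRing.scale /=.
- transitivity (d.1 * (t1 ^+ 2 + t2 ^+ 2) + 2 * cross (t1, t2) d * t2).
    by rewrite /dot /cross /rot90 /=; ring.
  by rewrite tu /dot /cross /rot90 /=; ring.
- transitivity (d.2 * (t1 ^+ 2 + t2 ^+ 2) - 2 * cross (t1, t2) d * t1).
    by rewrite /dot /cross /rot90 /=; ring.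
  by rewrite tu /dot /cross /rot90 /=; ring.
Qed.

(** The flight arrives from the left ([arrives_from_left]); this makes the sine of
    the outgoing angle positive, so that the new chart point lies over side [k]. *)
Lemma step_flip j k y : step j k y ->
  [/\ over k (flip j k y), dir k (flip j k y).1 = Defs.reflect k (dir j y.1) &
   exists2 t, 0 < t &
    foot k (of_chart (flip j k y)).1 = foot j (of_chart y).1 + t *: dir j y.1 /\
    forall t', 0 < t' < t -> ~ pline (foot j (of_chart y).1 + t' *: dir j y.1)].
Proof.
move=> [oj gl nx]; have [s0 uj Hu] := over_foot oj.
have d1 := dir_unit j y.1.
have dj : 0 < cross (T j) (dir j y.1) by rewrite cross_tangent_dir.
have [t t0 [w wk [wE av]]] := next_crossing_flight d1 gl uj Hu nx.
have dk := arrives_from_left d1 gl uj Hu dj nx.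
have [th sE cE] := flip_angle oj.1 dk.
have Hw : H (dir j y.1) (ray_level j y) (pt k w) = 0.
  by rewrite wE heightD Hu crossxx mulr0 addr0.
have qE : (flip j k y).2 = (arc k + w) * sin (turn j k - y.1).
  have : vertex_offset j k y.1 - y.2 = w * sin (turn j k - y.1).
    by move: Hw; rewrite /pt heightD vertex_heightE sE; lra.
  by rewrite /flip /shift /vertex_offset /=; lra.
have s0' := sin_gt0_pi th.
have sk : (of_chart (flip j k y)).1 = arc k + w.
  by rewrite -[LHS]/((flip j k y).2 / sin (turn j k - y.1)) qE mulfK// gt_eqF.
split.
- split=> //=; rewrite -[_ - y.2]/((flip j k y).2) qE.
  by case/andP: wk => w0 w1; rewrite !ltr_pM2r// ltrDl w0 ltrD2l.
- by apply: dir_reflect; rewrite /= ?sE ?cE.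
- exists t => //; split=> //.
  by rewrite sk /foot (_ : arc k + w - arc k = w); [exact: wE|ring].
Qed.

Lemma over_phase j y : over j y -> on_side j (of_chart y).1 /\ phase Q (of_chart y).
Proof.
move=> oj; have [s0 uj Hu] := over_foot oj.
have os : on_side j (of_chart y).1 by rewrite /on_side /=; lra.
split=> //; exists j; split; [exact: os|exact: oj.1|].
have [|e e0 he] := leave_left uj (d := dir j y.1); first by rewrite cross_tangent_dir.
by exists e.
Qed.

Lemma foot_over j y : over j y -> exists2 u, 0 < u < len j & foot j (of_chart y).1 = pt j u.
Proof. by move=> /over_foot[_ uj _]; exists ((of_chart y).1 - arc j). Qed.

Lemma step_billiard j k y : step j k y ->
  billiard_map Q (of_chart y) (of_chart (flip j k y)).
Proof.
move=> st; have [ok dE [t t0 [fE av]]] := step_flip st.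
have [oj _ _] := st.
have [osj phj] := over_phase oj; have [osk phk] := over_phase ok.
split=> //; exists j, k; split=> //; exists t; split=> //.
- apply: enclosed_along => // e e0.
  have [u uj ->] := foot_over oj.
  have dj : 0 < cross (T j) (dir j y.1).
    by rewrite cross_tangent_dir; have [] := over_foot oj.
  have [e' e'0 he] := leave_left uj dj.
  have m0 : 0 < Num.min e e' by rewrite lt_min e0.
  exists (Num.min e e' / 2).
    have : Num.min e e' <= e by rewrite ge_min lexx.
    by lra.
  apply: he; have : Num.min e e' <= e' by rewrite ge_min lexx orbT.
  by lra.
- move=> i; have [u uk ->] := foot_over ok.
  rewrite -pt0 => /(open_pt_inj uk)[|_ u0]; last by move: uk; rewrite u0 ltxx.
  by rewrite lexx ltW// side_length_gt0.
Qed.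

Lemma of_to_chart x : 0 < x.2 < pi -> of_chart (to_chart x) = x.
Proof.
move=> /sin_gt0_pi s0; rewrite /of_chart /to_chart /= mulfK ?gt_eqF//.
by case: x {s0}.
Qed.

Lemma over_to_chart j x : 0 < x.2 < pi -> arc j < x.1 < arc j + len j ->
  over j (to_chart x).
Proof.
move=> th /andP[x1 x2]; split=> //=; have s0 := sin_gt0_pi th.
by rewrite !ltr_pM2r ?x1.
Qed.

Lemma generic_step j y : over j y -> (forall i, vertex_offset j i y.1 <> y.2) ->
  exists k, step j k y.
Proof.
move=> oj gen; have [s0 uj Hu] := over_foot oj.
have gl : generic_line (dir j y.1) (ray_level j y).
  by move=> i; rewrite vertex_heightE => /subr0_eq; exact: gen.
have [|k nx] := next_crossing_exists (dir_unit j y.1) gl uj Hu.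
  by rewrite cross_tangent_dir.
by exists k.
Qed.

(** * Injectivity and stability *)

Lemma arc_ge0 (j : side) : 0 <= arc j.
Proof. by apply: sumr_ge0 => i _; rewrite ltW// side_length_gt0. Qed.

Lemma arc_le i j : (i < j)%N -> arc i + len i <= arc j.
Proof.
move=> ij; rewrite /arc_start [leRHS](bigID (fun l : side => (l < i)%N)) /=.
have -> : \sum_(l < nsides Q | (l < j)%N && (l < i)%N) len l =
    \sum_(l < nsides Q | (l < i)%N) len l.
  by apply: eq_bigl => l; rewrite andb_idl// => li; exact: ltn_trans ij.
rewrite lerD2l (bigD1 i) /=; last by rewrite ij ltnn.
by rewrite lerDl sumr_ge0// => l _; rewrite ltW// side_length_gt0.
Qed.

Lemma over_inj j k y : over j y -> over k y -> j = k.
Proof.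
have gen (i i' : side) : (i < i')%N -> over i y -> over i' y -> False.
  move=> /arc_le le [/sin_gt0_pi s0 /andP[_ h1]] [_ /andP[h2 _]].
  have := lt_trans h2 h1; rewrite ltr_pM2r//; lra.
move=> oj ok; apply/val_inj => /=; apply/eqP.
case: ltngtP => // jk; exfalso; [exact: gen jk oj ok|exact: gen jk ok oj].
Qed.

Lemma reflectK k d : Defs.reflect k (Defs.reflect k d) = d.
Proof.
rewrite /Defs.reflect /normal; have := tangent_unit k; case: (T k) => t1 t2 /= tu.
apply: injective_projections; rewrite /= /dot /rot90 /= /GRing.scale /=.
- transitivity (d.1 + 4 * t2 * (d.1 * t2 - d.2 * t1) * (1 - (t1 ^+ 2 + t2 ^+ 2)) * (-1)); first by ring.
  by rewrite tu; ring.
- transitivity (d.2 + 4 * t1 * (d.1 * t2 - d.2 * t1) * (1 - (t1 ^+ 2 + t2 ^+ 2))); first by ring.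
  by rewrite tu; ring.
Qed.

(** Followed backwards from its arrival point, a flight first meets the boundary at
    its starting point. *)
Lemma flip_inj j k j' k' y y' : step j k y -> step j' k' y' ->
  flip j k y = flip j' k' y' -> j = j' /\ k = k'.
Proof.
move=> st st' e.
have [ok dE [t t0 [fE av]]] := step_flip st.
have [ok' dE' [t' t'0 [fE' av']]] := step_flip st'.
have kk : k = k' by apply: (over_inj ok); rewrite e.
subst k'; split=> //.
have [oj _ _] := st; have [oj' _ _] := st'.
have dd : dir j' y'.1 = dir j y.1.
  by rewrite -(reflectK k (dir j' _)) -dE' -e dE reflectK.
move: fE' av'; rewrite -e fE dd; move: av.
have [u uj ->] := foot_over oj; have [u' uj' ->] := foot_over oj' => av E av'.
have on i w : 0 < w < len i -> pline (pt i w).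
  by move=> wi; apply/polylineP; exists i, w; split=> //; lra.
have shiftE x z : x + t *: dir j y.1 = z + t' *: dir j y.1 -> x = z + (t' - t) *: dir j y.1.
  by move=> xz; apply: (addIr (t *: dir j y.1)); rewrite -addrA -scalerDl subrK.
have uj'' : 0 <= u' <= len j' by lra.
case: (ltgtP t t') => tt; last first.
- by have := shiftE _ _ E; rewrite tt subrr scale0r addr0 => /(open_pt_inj uj uj'')[].
- exfalso; apply: (av (t - t')); first by lra.
  have := on _ _ uj'; rewrite (_ : pt j' u' = pt j u + (t - t') *: dir j y.1)//.
  by rewrite scalerBl addrA E addrK.
- exfalso; apply: (av' (t' - t)); first by lra.
  by rewrite -(shiftE _ _ E); exact: on.
Qed.

(** Both functions are trigonometric polynomials of degree one in the angle. *)
Lemma offset_lipschitz : exists2 K : R, 0 <= K & forall (j i : side) (a b : R),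
  `|vertex_offset j i a - vertex_offset j i b| <= K * `|a - b| /\
  `|shift j i a - shift j i b| <= K * `|a - b|.
Proof.
pose A (p : side * side) := cross (vtx p.2 - vtx p.1) (T p.1).
pose B (p : side * side) := cross (vtx p.2 - vtx p.1) (rot90 (T p.1)) + arc p.1.
pose C (p : side * side) := arc p.2.
have [K K0 hK] := finite_bound (fun p => `|A p| + `|B p| + `|C p|).
exists K => // j i a b.
have lip (c : R) : `|c| <= `|C (j, i)| ->
  `|(A (j, i) * cos a + B (j, i) * sin a + c * sin (turn j i - a)) -
    (A (j, i) * cos b + B (j, i) * sin b + c * sin (turn j i - b))| <= K * `|a - b|.
  move=> hc; apply: le_trans (trig_lipschitz _ _ _ _ _ _) _; rewrite ler_wpM2r//.
  by apply: le_trans (hK (j, i)); rewrite lerD2l.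
have dE (t : R) : cross (vtx i - vtx j) (dir j t) =
    cross (vtx i - vtx j) (T j) * cos t + cross (vtx i - vtx j) (rot90 (T j)) * sin t.
  by rewrite dirE /cross /= /GRing.scale /=; ring.
split.
  have := lip 0; rewrite normr0 normr_ge0 => /(_ isT).
  congr (_ <= _); congr (`| _ - _|); rewrite /vertex_offset dE /A /B /=; ring.
have := lip (arc i) (lexx _).
congr (_ <= _); congr (`| _ - _|); rewrite /shift dE /A /B /=; ring.
Qed.

Section Stability.
Variable K : R.
Hypothesis K0 : 0 <= K.
Hypothesis lipK : forall j i (a b : R),
  `|vertex_offset j i a - vertex_offset j i b| <= K * `|a - b| /\
  `|shift j i a - shift j i b| <= K * `|a - b|.

(** Deform the first ray linearly into the second: the heights of the vertices
    never vanish, so the order of the crossings cannot change. *)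
Lemma step_stable j k y y' : step j k y -> 0 < y'.1 < pi ->
  (forall i, K * `|y.1 - y'.1| + `|y.2 - y'.2| < `|vertex_offset j i y.1 - y.2|) ->
  step j k y'.
Proof.
move=> [oj gl nx] th' close.
pose yt (t : R) : R * R := (y.1 + t * (y'.1 - y.1), y.2 + t * (y'.2 - y.2)).
have yt0 : yt 0 = y by rewrite /yt !mul0r !addr0; case: (y).
have yt1 : yt 1 = y' by rewrite /yt !mul1r !subrKC; case: (y').
have near t i : 0 <= t <= 1 ->
    `|(vertex_offset j i (yt t).1 - (yt t).2) - (vertex_offset j i y.1 - y.2)|
      < `|vertex_offset j i y.1 - y.2|.
  move=> /andP[t0 t1]; apply: le_lt_trans (close i).
  rewrite (_ : _ - _ = (vertex_offset j i (yt t).1 - vertex_offset j i y.1) - ((yt t).2 - y.2)); last by ring.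
  apply: le_trans (ler_normB _ _) _; apply: lerD.
    have [lo _] := lipK j i (yt t).1 y.1; apply: le_trans lo _; rewrite ler_wpM2l// /yt /= addrAC subrr add0r.
    by rewrite normrM (ger0_norm t0) distrC ler_piMl.
  by rewrite /yt /= addrAC subrr add0r normrM (ger0_norm t0) distrC ler_piMl.
have nz t i : 0 <= t <= 1 -> vertex_offset j i (yt t).1 - (yt t).2 <> 0.
  by move=> t01 e; have := near t i t01; rewrite e sub0r normrN ltxx.
have o1 : 0 <= (1 : R) <= 1 by rewrite ler01 lexx.
have oj' : over j y'.
  move/overP: oj => [_ h1 h2]; apply/overP; split=> //.
    by have := near 1 j o1; rewrite yt1 (ltr0_norm h1) ltr_norml => /andP[_]; lra.
  by have := near 1 (ordS j) o1; rewrite yt1 (gtr0_norm h2) ltr_norml => /andP[+ _]; lra.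
have ca : continuous (fun t : R => (yt t).1 : R).
  by move=> t; rewrite /yt /=; do !(first [exact: cvg_cst|exact: cvg_id|apply: cvgD|apply: cvgM]).
have cb : continuous (fun t : R => (yt t).2 : R).
  by move=> t; rewrite /yt /=; do !(first [exact: cvg_cst|exact: cvg_id|apply: cvgD|apply: cvgM]).
have cc : continuous (fun t : R => cos (yt t).1 : R).
  by move=> t; apply: (@continuous_comp _ _ _ (fun t : R => (yt t).1) cos); [exact: ca|exact: continuous_cos].
have cs : continuous (fun t : R => sin (yt t).1 : R).
  by move=> t; apply: (@continuous_comp _ _ _ (fun t : R => (yt t).1) sin); [exact: ca|exact: continuous_sin].
have cd1 : continuous (fun t : R => (dir j (yt t).1).1 : R).
  by move=> t; do !(first [exact: cvg_cst|exact: cc|exact: cs|apply: cvgD|apply: cvgM]).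
have cd2 : continuous (fun t : R => (dir j (yt t).1).2 : R).
  by move=> t; do !(first [exact: cvg_cst|exact: cc|exact: cs|apply: cvgD|apply: cvgM]).
have cl : continuous (fun t : R => ray_level j (yt t) : R).
  by move=> t; exact: (cvgD (cvgB (cvgB (cvgM (cvg_cst (vtx j).1) (@cd2 t))
    (cvgM (cvg_cst (vtx j).2) (@cd1 t))) (cvgM (cvg_cst (arc j)) (@cs t))) (@cb t)).
have glt t : 0 <= t <= 1 -> generic_line (dir j (yt t).1) (ray_level j (yt t)).
  by move=> t01 i; rewrite vertex_heightE; exact: nz.
have := next_crossing_path cd1 cd2 cl (fun t => dir_unit j (yt t).1) glt.
rewrite yt0 yt1 => /(_ j k nx) nx'; split=> //.
by have := glt 1 o1; rewrite yt1.
Qed.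

(** The difference of the angles only changes sign, so that the chart distance
    grows at most linearly in time. Closeness to the reference orbit keeps the
    second ray on the same pieces, by [step_stable]. *)
Lemma shadowing (n : nat) (c : nat -> side) (x x' : nat -> R * R) (a b : R) :
  (forall m, (m < n)%N -> [/\ step (c m) (c m.+1) (x m),
     x m.+1 = flip (c m) (c m.+1) (x m) &
     forall i, m.+1%:R * (K * a) + b < `|vertex_offset (c m) i (x m).1 - (x m).2|]) ->
  `|(x 0%N).1 - (x' 0%N).1| <= a -> `|(x 0%N).2 - (x' 0%N).2| <= b ->
  0 < (x' 0%N).1 < pi ->
  (forall m, x' m.+1 = flip (c m) (c m.+1) (x' m)) ->
  forall m, (m < n)%N -> step (c m) (c m.+1) (x' m).
Proof.
move=> hx ha hb th0 hx' m mn.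
have key : forall l, (l <= m)%N -> [/\ 0 < (x' l).1 < pi, `|(x l).1 - (x' l).1| <= a &
    `|(x l).2 - (x' l).2| <= b + l%:R * (K * a)].
  elim=> [|l IH] lm; first by rewrite mul0r addr0.
  have [th h1 h2] := IH (ltnW lm).
  have [st xE far] := hx l (leq_ltn_trans (ltnW lm) mn).
  have st' : step (c l) (c l.+1) (x' l).
    apply: (step_stable st th) => i.
    apply: le_lt_trans (far i); have := ler_wpM2l K0 h1.
    by rewrite -natr1 mulrDl mul1r; lra.
  have [[thf _] _ _] := step_flip st'.
  rewrite hx' xE; split=> //.
    by rewrite /flip /= (_ : _ - _ = (x' l).1 - (x l).1) 1?distrC//; ring.
  rewrite /flip /= (_ : _ - _ = (shift (c l) (c l.+1) (x l).1 - shift (c l) (c l.+1) (x' l).1)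
     - ((x l).2 - (x' l).2)); last by ring.
  apply: le_trans (ler_normB _ _) _.
  have [_ h3] := lipK (c l) (c l.+1) (x l).1 (x' l).1.
  have := ler_wpM2l K0 h1.
  by rewrite -natr1 mulrDl mul1r; lra.
have [th h1 h2] := key m (leqnn m); have [st _ far] := hx m mn.
apply: (step_stable st th) => i.
apply: le_lt_trans (far i); have := ler_wpM2l K0 h1.
by rewrite -natr1 mulrDl mul1r; lra.
Qed.

End Stability.

Lemma step_coding (n : nat) (c : nat -> side) (x : nat -> R * R) z : (0 < n)%N ->
  0 < z.2 < pi -> x 0%N = to_chart z ->
  (forall m, x m.+1 = flip (c m) (c m.+1) (x m)) ->
  (forall m, (m < n)%N -> step (c m) (c m.+1) (x m)) ->
  coding z [tuple c (val k) | k < n.+1].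
Proof.
move=> n0 th x0 xS st.
have ov m : (m <= n)%N -> over (c m) (x m).
  case: m => [_|m mn]; first by have [] := st 0%N n0.
  by rewrite xS; have [] := step_flip (st m mn).
exists (fun m => of_chart (x m)); split.
- by rewrite x0 of_to_chart.
- by move=> m mn; rewrite xS; exact: step_billiard (st m mn).
- move=> k; have [os ph] := over_phase (ov k (ltn_ord k)).
  by rewrite tnth_mktuple.
Qed.

(** * The area of the bad sets *)

Lemma measurable_offset j i : measurable_fun setT (vertex_offset j i).
Proof.
have := measurable_trig (cross (vertex i - vertex j) (tangent j))
  (cross (vertex i - vertex j) (rot90 (tangent j)) + arc j) 0 0.
congr (measurable_fun _ _); apply/funext => a.
by rewrite /vertex_offset dirE /cross /= /GRing.scale /=; ring.
Qed.

Lemma measurable_shift j k : measurable_fun setT (shift j k).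
Proof.
have := measurable_trig (cross (vertex k - vertex j) (tangent j))
  (cross (vertex k - vertex j) (rot90 (tangent j)) + arc j) (arc k) (turn j k).
congr (measurable_fun _ _); apply/funext => a.
by rewrite /shift dirE /cross /= /GRing.scale /=; ring.
Qed.

(** The least distance of a vertex to the line bounds an admissible perturbation. *)
Lemma step_open j k : open (step j k).
Proof.
have [K K0 hK] := offset_lipschitz.
rewrite openE => y st; have [[th _] gl _] := st.
have [|e e0] := @pos_lower_bound R (y.1 :: pi - y.1 ::
    [seq `|vertex_offset j i y.1 - y.2| | i : side]).
  rewrite /= subr_gt0; case/andP: th => -> -> /=; apply/allP => _ /mapP[i _ ->].
  by rewrite normr_gt0; apply/eqP => h; apply: (gl i); rewrite vertex_heightE.
move=> /= /and3P[e1 e2 /allP he].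
have Kp : 0 < K + 1 by lra.
have r0 : 0 < e / (K + 1) by rewrite divr_gt0.
have re : e / (K + 1) * (K + 1) = e by rewrite divfK// gt_eqF.
set r := e / (K + 1) in r0 re.
apply/nbhs_ballP; exists r => //= y' [/=]; rewrite /ball /= => h1 h2.
apply: (step_stable K0 hK st) => [|i].
  have re' : r <= e by nra.
  by move: h1; rewrite ltr_norml => /andP[? ?]; lra.
apply: (@lt_trans _ _ e); last by apply: he; apply: map_f; rewrite mem_enum.
by rewrite -re mulrDr mulr1 mulrC; apply: ler_ltD => //; rewrite ler_wpM2r// ltW.
Qed.

(** The distance is taken to the whole line of the ray and not to its flight alone:
    at a shallow arrival a line may pass close to a vertex that is far from the
    flight, and a slightly different ray may then reach that vertex. *)
Definition near_vertex (delta : R) : set (R * R) :=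
  [set y | exists p : side * side, 0 <= y.1 <= pi /\ `|vertex_offset p.1 p.2 y.1 - y.2| <= delta].

Definition preimage_flip (A : set (R * R)) : set (R * R) :=
  [set y | exists p : side * side, step p.1 p.2 y /\ A (flip p.1 p.2 y)].

Lemma near_vertex_measure : exists2 M : R, 0 <= M & forall delta, 0 <= delta ->
  measurable (near_vertex delta) /\ (leb2 (near_vertex delta) <= (M * delta)%:E)%E.
Proof.
have fI : finite_set [set: side * side] by exact: finite_finset.
exists (\sum_(p \in [set: side * side]) (pi * 2 : R)).
  by rewrite fsbig_finite//= sumr_ge0// => _ _; rewrite mulr_ge0// pi_ge0.
move=> delta d0.
pose D (p : side * side) : set (R * R) :=
  [set y | 0 <= y.1 <= pi /\ `|vertex_offset p.1 p.2 y.1 - y.2| <= delta].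
have mD p : measurable (D p) /\ leb2 (D p) = (pi * (2 * delta))%:E.
  exact: band_measure (pi_ge0 R) d0 (measurable_offset _ _).
have E : near_vertex delta = \bigcup_(p in setT) D p.
  by apply/seteqP; split=> y [p]; [exists p|move=> _ ?; exists p].
have mN : measurable (near_vertex delta).
  by rewrite E; apply: fin_bigcup_measurable => // p _; exact: (mD p).1.
split=> //.
apply: (@le_trans _ _ (\sum_(p \in setT) leb2 (D p))%E).
  by apply: content_sub_fsum => // [p _|]; [exact: (mD p).1|rewrite E].
rewrite (eq_fsbigr (fun=> (pi * (2 * delta))%:E)); last by move=> p _; exact: (mD p).2.
rewrite !fsbig_finite//= sumEFin lee_fin mulr_suml.
by apply: ler_sum => p _; rewrite mulrA.
Qed.

Lemma preimage_flip_measure A : measurable A ->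
  measurable (preimage_flip A) /\ (leb2 (preimage_flip A) <= leb2 A)%E.
Proof.
move=> mA.
have := @piecewise_flip_measure R (side * side)%type (fun p => step p.1 p.2)
  (fun p => turn p.1 p.2) (fun p => @shift p.1 p.2) A.
apply => //.
- by move=> p; apply: open_measurable_plane; exact: step_open.
- by move=> p; exact: measurable_shift.
- by move=> [j k] [j' k'] y y' st st' /(flip_inj st st')[/= -> ->].
Qed.

Definition near_vertex_after l (delta : R) := iter l preimage_flip (near_vertex delta).

(** Preimages under the billiard map gain no area, so the bound for [near_vertex]
    persists at all times. *)
Lemma near_vertex_after_measure : exists2 M : R, 0 <= M & forall l delta, 0 <= delta ->
  measurable (near_vertex_after l delta) /\
  (leb2 (near_vertex_after l delta) <= (M * delta)%:E)%E.
Proof.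
have [M M0 hM] := near_vertex_measure; exists M => // l delta d0.
elim: l => [|l [mA le]]; first exact: hM.
have [mP leP] := preimage_flip_measure mA; split; first exact: mP.
exact: le_trans leP le.
Qed.

(** Distances grow linearly in time, hence the factor [m.+1]. *)
Definition bad n (c : R) : set (R * R) :=
  [set y | exists2 m, (m < n)%N & near_vertex_after m (m.+1%:R * c) y].

(** Sum the linear bounds over [m < n]. *)
Lemma bad_measure : exists2 M : R, 0 <= M & forall n c, 0 <= c ->
  measurable (bad n c) /\ (leb2 (bad n c) <= (M * n%:R ^+ 2 * c)%:E)%E.
Proof.
have [M M0 hM] := near_vertex_after_measure; exists M => // n c c0.
have mc m : 0 <= m.+1%:R * c by rewrite mulr_ge0.
have E : bad n c = \bigcup_(m in `I_n) near_vertex_after m (m.+1%:R * c).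
  by apply/seteqP; split=> y [m]; exists m.
have mB : measurable (bad n c).
  by rewrite E; apply: fin_bigcup_measurable => // m _; exact: (hM m _ (mc m)).1.
split=> //.
apply: (@le_trans _ _ (\sum_(m \in `I_n) leb2 (near_vertex_after m (m.+1%:R * c)))%E).
  by apply: content_sub_fsum => // m _; exact: (hM m _ (mc m)).1.
apply: (@le_trans _ _ (\sum_(m \in `I_n) (M * (n%:R * c))%:E)%E).
  apply: lee_fsum => // m mn; apply: le_trans (hM m _ (mc m)).2 _.
  by rewrite lee_fin ler_wpM2l// ler_wpM2r// ler_nat.
rewrite -fsbig_ord /= sumEFin lee_fin sumr_const card_ord -[leLHS]mulr_natr.
by rewrite le_eqVlt; apply/orP; left; apply/eqP; ring.
Qed.

(** Constant where the ray hits no side in the interior, so that orbits are total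
    sequences. *)
Definition next_state (p : side * (R * R)) : side * (R * R) :=
  if [pick k | `[< step p.1 k p.2 >]] is Some k then (k, flip p.1 k p.2) else p.

(** Off the bad set no ray of the orbit passes close to a vertex, so each of them
    has a next side. *)
Lemma not_bad_orbit n (cst : R) j y : 0 <= cst -> over j y -> ~ bad n cst y ->
  exists c : nat -> side, exists x : nat -> R * R, x 0%N = y /\
    forall m, (m < n)%N -> [/\ step (c m) (c m.+1) (x m),
      x m.+1 = flip (c m) (c m.+1) (x m) &
      forall i, m.+1%:R * cst < `|vertex_offset (c m) i (x m).1 - (x m).2|].
Proof.
move=> c0 oj nb; pose p m := iter m next_state (j, y).
exists (fun m => (p m).1), (fun m => (p m).2); split=> //.
have far m : over (p m).1 (p m).2 ->
    ~ near_vertex (m.+1%:R * cst) (p m).2 ->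
    forall i, m.+1%:R * cst < `|vertex_offset (p m).1 i (p m).2.1 - (p m).2.2|.
  move=> [/andP[th1 th2] _] nn i; rewrite ltNge; apply/negP => h; apply: nn.
  by exists ((p m).1, i); split=> //=; rewrite !ltW.
have nxt m : over (p m).1 (p m).2 ->
    (forall i, m.+1%:R * cst < `|vertex_offset (p m).1 i (p m).2.1 - (p m).2.2|) ->
    step (p m).1 (p m.+1).1 (p m).2 /\
    (p m.+1).2 = flip (p m).1 (p m.+1).1 (p m).2.
  move=> ov hf; have [|k st] := generic_step ov.
    move=> i e; have := hf i; rewrite e subrr normr0 ltNge.
    by rewrite mulr_ge0.
  rewrite /p iterS -/(p m) /next_state; case: pickP => [k' /asboolP st'//|/(_ k)].
  by move/asboolP.
have inv m : (m < n)%N -> over (p m).1 (p m).2 /\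
    (forall l, (m + l < n)%N -> ~ near_vertex_after l ((m + l).+1%:R * cst) (p m).2).
  elim: m => [|m IH] mn.
    by split=> // l ln h; apply: nb; exists l.
  have [ov nn] := IH (ltnW mn).
  have hf := far m ov; have := nn 0%N; rewrite addn0 => /(_ (ltnW mn)) /hf {}hf.
  have [st e] := nxt m ov hf; have [ov' _ _] := step_flip st.
  rewrite e; split=> // l ln h; apply: (nn l.+1); rewrite -?addSnnS//.
  by exists ((p m).1, (p m.+1).1).
move=> m mn; have [ov nn] := inv m mn.
have hf := far m ov; have := nn 0%N; rewrite addn0 => /(_ mn) /hf {}hf.
by have [st e] := nxt m ov hf.
Qed.

(** The factor [C] absorbs the passage from the L1 metric to the chart and the
    growth of distances along the orbit ([shadowing]). *)
Lemma common_coding : exists2 C : R, 0 <= C & forall n (e : R) (j : side) (z : R * R),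
  (0 < n)%N -> 0 <= e -> 0 < z.2 < pi -> over j (to_chart z) ->
  ~ bad n (C * e) (to_chart z) ->
  exists c : n.+1.-tuple side, forall w, ball1 Q z e w -> coding w c.
Proof.
have [K K0 hK] := offset_lipschitz.
have [A A0 hA] := finite_bound (fun j : side => arc j + len j).
(* [K] bounds the growth per step; [A + 1] compares the chart with the L1 metric. *)
exists (K + A + 1); first by lra.
move=> n e j z n0 e0 zth oj nb.
have Ce0 : 0 <= (K + A + 1) * e by rewrite mulr_ge0//; lra.
have [c [x [x0 hx]]] := not_bad_orbit Ce0 oj nb.
exists [tuple c (val k) | k < n.+1] => w [phw zw].
have [_ [_ wth _]] := phw.
have zA : `|z.1| <= A.
  have [_ + _] := over_foot oj; rewrite /to_chart /= mulfK; last by rewrite gt_eqF// sin_gt0_pi.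
  have := arc_ge0 j; have := hA j; rewrite ler_norml; lra.
have th1 : `|z.2 - w.2| <= e.
  by have := normr_ge0 (z.1 - w.1); lra.
have q1 : `|z.1 * sin z.2 - w.1 * sin w.2| <= (A + 1) * e.
  rewrite (_ : _ - _ = z.1 * (sin z.2 - sin w.2) + (z.1 - w.1) * sin w.2); last by ring.
  apply: le_trans (ler_normD _ _) _; rewrite !normrM mulrDl mul1r.
  apply: lerD.
    by apply: ler_pM => //; apply: le_trans (sin_lipschitz _ _) _.
  apply: (@le_trans _ _ `|z.1 - w.1|); last by have := normr_ge0 (z.2 - w.2); lra.
  by rewrite ler_piMr// ler_norml sin_geN1 sin_le1.
pose x' := fix x' m := if m is m'.+1 then flip (c m') (c m) (x' m') else to_chart w.
apply: (@step_coding n c x') => //.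
apply: (@shadowing K K0 hK n c x x' e ((A + 1) * e)) => //; rewrite ?x0//.
move=> m mn; have [st xS far] := hx m mn; split=> // i.
apply: le_lt_trans (far i).
have : 0 <= m%:R * ((A + 1) * e) by rewrite !mulr_ge0//; lra.
by rewrite -natr1 !mulrDl; lra.
Qed.

Lemma vertex_lines_null :
  let V := [set z : R * R | exists j : side, z.1 = arc j] in
  measurable V /\ leb2 V = 0%E.
Proof.
move=> V.
have E : V = \bigcup_(j in [set: side]) ([set arc j] `*` setT).
  by apply/seteqP; split=> z [j]; [exists j|move=> _ []; exists j].
have fI : finite_set [set: side] by exact: finite_finset.
have m1 (j : side) : measurable ([set arc j] `*` [set: R]).
  by apply: measurableX => //; exact: measurable_set1.
have mV : measurable V by rewrite E; apply: fin_bigcup_measurable.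
split=> //; apply/eqP; rewrite eq_le measure_ge0 andbT.
apply: (@le_trans _ _ (\sum_(j \in [set: side]) leb2 ([set arc j] `*` [set: R]))%E).
  by apply: content_sub_fsum => // [j _|]; [exact: m1|rewrite -E].
rewrite fsbig1// => j _; rewrite product_measure1E//.
transitivity (leb [set arc j] * leb [set: R])%E => //.
by rewrite lebesgue_measure_set1 mul0e.
Qed.

Section Radius.
Variable f : nat -> nat.
Hypothesis f_mono : forall m n : nat, (m <= n)%N -> (f m <= f n)%N.
Hypothesis f_unbounded : forall M : nat, exists n : nat, (M <= f n)%N.

Definition radius n : R := 1 / (n%:R ^+ 2 * (f n)%:R).

Lemma radius_gt0 n : (0 < n)%N -> (0 < f n)%N -> 0 < radius n.
Proof. by move=> n0 f0; rewrite divr_gt0// mulr_gt0 ?exprn_gt0 ?ltr0n. Qed.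

(** The bad set at time [n] has area O(1/f(n)), and [f] is unbounded. *)
Lemma eventually_bad_null (C : R) : 0 <= C ->
  let W := \bigcup_N \bigcap_(n in [set n | (N <= n)%N]) bad n (C * (2 * radius n)) in
  measurable W /\ leb2 W = 0%E.
Proof.
move=> C0 W; have [M M0 hM] := bad_measure.
have r0 n : 0 <= C * (2 * radius n).
  by rewrite !mulr_ge0// /radius divr_ge0// mulr_ge0.
have mI N : measurable (\bigcap_(n in [set n | (N <= n)%N]) bad n (C * (2 * radius n))).
  apply: bigcap_measurable => [|n _]; first by exists N => /=.
  exact: (hM n _ (r0 n)).1.
have mW : measurable W by exact: bigcupT_measurable.
split=> //; apply: measure_negligible; first exact: mW.
apply: negligible_bigcup => N.
exists (\bigcap_(n in [set n | (N <= n)%N]) bad n (C * (2 * radius n))).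
split=> //; first exact: mI.
apply/eqP; rewrite eq_le measure_ge0 andbT.
apply/lee_addgt0Pr => e e0; rewrite add0e.
pose p := (Num.truncn (M * C * 2 / e)).+1.
have pe : M * C * 2 / e < p%:R by exact: truncnS_gt.
have [n0 hn0] := f_unbounded p.
pose n := maxn n0 (maxn N 1).
have fn : (p <= f n)%N by apply: leq_trans hn0 _; apply: f_mono; exact: leq_maxl.
have n1 : (0 < n)%N by rewrite !leq_max !orbT.
have nN : (N <= n)%N by rewrite !leq_max leqnn ?orbT.
have f0 : (0 < f n)%N by exact: leq_trans fn.
apply: (@le_trans _ _ (leb2 (bad n (C * (2 * radius n))))).
  apply: le_measure_plane => //; first exact: (hM n _ (r0 n)).1.
  by move=> y; apply.
apply: le_trans (hM n _ (r0 n)).2 _; rewrite lee_fin.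
have -> : M * n%:R ^+ 2 * (C * (2 * radius n)) = M * C * 2 / (f n)%:R.
  by rewrite /radius; field; rewrite !gt_eqF// ltr0n.
rewrite ler_pdivrMr ?ltr0n//; move: pe; rewrite ltr_pdivrMr// => pe.
apply: le_trans (ltW pe) _; rewrite mulrC ler_pM2l//.
by rewrite ler_nat.
Qed.

End Radius.

End Polygon.

(** * Points with large cells *)

Theorem theorem5 (R : realType) (Q : polygon R) (f : nat -> nat)
    (f_mono : forall m n : nat, (m <= n)%N -> (f m <= f n)%N)
    (f_unbounded : forall M : nat, exists n : nat, (M <= f n)%N) :
  exists G : set (R * R),
    [/\ dense_in_phase Q G, Gdelta_in_phase Q G, full_measure Q G &
     forall z : R * R, G z ->
       exists u : nat -> nat,
         [/\ forall i j : nat, (i < j)%N -> (u i < u j)%N,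
             forall i : nat, (0 < u i)%N /\ (0 < f (u i))%N &
             forall i : nat,
               ball1 Q z (1 / ((u i)%:R ^+ 2 * (f (u i))%:R))
                 `<=` cell Q (u i) z]].
Proof.
have [n1 n1P] : exists n1, forall n, (n1 <= n)%N -> (0 < n)%N /\ (0 < f n)%N.
  have [n0 fn0] := f_unbounded 1%N; exists (maxn n0 1) => n.
  rewrite geq_max => /andP[n0n n0']; split=> //.
  by apply: leq_trans fn0 _; exact: f_mono.
have [C C0 hC] := common_coding Q.
have [mW W0] := eventually_bad_null Q f_mono f_unbounded C0.
set W := bigcup _ _ in mW W0.
pose eps n : R := radius R f n.
(* Twice the radius, so that the ball of radius [eps n] about any point within
   [eps n] of a good point still has a constant coding; this makes [U n] open. *)
pose good n (y : R * R) := phase Q y /\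
  exists c : n.+1.-tuple 'I_(nsides Q), forall w, ball1 Q y (2 * eps n) w -> coding w c.
pose U n := \bigcup_(y in good n) [set w | `|y.1 - w.1| + `|y.2 - w.2| < eps n].
pose V N := \bigcup_(n in [set n | (N <= n)%N /\ (n1 <= n)%N]) U n.
pose G := phase Q `&` \bigcap_N V N.
have [mL L0] := vertex_lines_null Q.
set L := [set z | exists j, _] in mL L0.
have [mS S0] := null_unscale (continuous_measurable_fun (@continuous_sin R)) mW W0.
set S := [set z | 0 < sin z.2 /\ _] in mS S0.
have LSm : measurable (L `|` S) by exact: measurableU.
have LS0 : (lebesgue_measure \x lebesgue_measure)%E (L `|` S) = 0%E.
  apply: measure_negligible => //.
  by apply: negligibleU; [exists L; split|exists S; split].
(* A point is lost only if its foot is a vertex or if it is eventually bad. *)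
have cover : phase Q `\` G `<=` L `|` S.
  move=> z [phz nG]; apply: contrapT => /not_orP[nL nS]; apply: nG; split=> // N _.
  have [j [osj zth _]] := phz.
  have ovj : over j (to_chart z).
    apply: over_to_chart => //; case/andP: osj => a1 ->; rewrite andbT.
    by rewrite lt_neqAle a1 andbT; apply/eqP => e; apply: nL; exists j.
  have /existsNP[n] : ~ forall n, (maxn N n1 <= n)%N ->
      bad Q n (C * (2 * eps n)) (to_chart z).
    move=> h; apply: nS; split; first exact: sin_gt0_pi.
    by exists (maxn N n1).
  move=> /not_implyP[]; rewrite geq_max => /andP[Nn n1n] nb.
  have [n0 f0] := n1P n n1n; have e0 : 0 < eps n by exact: radius_gt0.
  exists n; first by split.
  exists z; last by rewrite /= !subrr !normr0 addr0.
  split=> //; apply: (hC _ _ j _ n0 _ zth ovj nb).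
  by rewrite mulr_ge0// ltW.
exists G; split.
(* Sides are half-open, so a box to the right of [z] consists of points
   of the phase space, and it has positive area. *)
- split=> [z []//|z phz B nB].
  have [j [/andP[a1 a2] zth _]] := phz.
  have [r r0 hr] := nbhs_small nB.
  have [|e e0 /= /and5P[er e1 e2 e3 _]] := @pos_lower_bound R
    [:: r; arc_start j + side_length j - z.1; z.2; pi - z.2].
    by rewrite /= r0 !subr_gt0 a2; case/andP: zth => -> ->.
  pose X := `]z.1, z.1 + e[%classic `*` `]z.2 - e, z.2 + e[%classic : set (R * R).
  have mX : measurable X by apply: measurableX; exact: measurable_itv.
  have [w [[/= w1 w2] nLS]] : exists w, X w /\ ~ (L `|` S) w.
    apply: contrapT => no.
    have XS : X `<=` L `|` S.
      by move=> w Xw; apply: contrapT => nw; apply: no; exists w.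
    have := null_measure_sub mX LSm XS LS0.
    rewrite product_measure1E; [|exact: measurable_itv..].
    have len (a b : R) : a < b -> lebesgue_measure `]a, b[%classic = (b - a)%:E.
      by move=> ab; rewrite lebesgue_measure_itv /= lte_fin ab EFinB.
    have -> : (lebesgue_measure `]z.1, (z.1 + e)%R[%classic *
       lebesgue_measure `](z.2 - e)%R, (z.2 + e)%R[%classic)%E = (e * (2 * e))%:E :> \bar R.
      by rewrite !len; [rewrite -EFinM; congr (_%:E); ring|lra|lra].
    by move=> [] /eqP; rewrite gt_eqF// !mulr_gt0.
  rewrite !in_itv /= in w1 w2.
  have phw : phase Q w.
    have th : 0 < w.2 < pi by lra.
    have sw : arc_start j < w.1 < arc_start j + side_length j by lra.
    by have [_] := over_phase (over_to_chart th sw); rewrite of_to_chart.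
  exists w; split; first by apply: contrapT => nG; apply: nLS; exact: cover.
  have -> : w = z + (w - z) by rewrite addrC subrK.
  by apply: hr; split; rewrite /= ltr_norml; lra.
- exists (\bigcap_N V N) => //; exists V => // N.
  apply: bigcup_open => n _; apply: bigcup_open => y _; exact: dist_open.
- exists (L `|` S); split=> //.
  apply: (@null_integral _ _ R (lebesgue_measure \x lebesgue_measure)%E _ (L `|` S)) => // z [_ [j [_ zth _]]].
  by rewrite lee_fin ltW// sin_gt0_pi.
- move=> z [phz Gz].
  have [u [u_incr uP]] := @increasing_choice (fun n => (n1 <= n)%N /\ U n z)
    (fun N => let: ex_intro2 n (conj Nn n1n) Un := Gz N I in
       ex_intro2 _ _ n Nn (conj n1n Un)).
  exists u; split=> // i; have [n1i [y [_ [c hc]] zy]] := uP i; first exact: n1P.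
  move=> w [phw zw]; rewrite -[1 / _]/(eps (u i)) in zw.
  have tri (a b d : R) : `|a - d| <= `|a - b| + `|b - d|.
    by rewrite -{1}(subrK b a) -addrA ler_normD.
  have cz : coding z c.
    by apply: hc; split=> //; rewrite /= in zy; have := normr_ge0 (y.1 - z.1);
      have := normr_ge0 (y.2 - z.2); lra.
  split=> //; exists (eps (u i) - (`|z.1 - w.1| + `|z.2 - w.2|)); first by rewrite subr_gt0.
  move=> w' [phw' ww']; exists c; split=> //; apply: hc; split=> //.
  have := tri y.1 z.1 w'.1; have := tri y.2 z.2 w'.2.
  have := tri z.1 w.1 w'.1; have := tri z.2 w.2 w'.2.
  by rewrite /= in zy; lra.
Qed.
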